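(* Suppose that $X$ and $H$ are Hopf algebras with bicovariant differential structure, and that $\pi:X\to H$ is a surjective differentiable Hopf algebra map. Additionally suppose that (1) $\pi:X\to H$ satisfies condition K, i.e. $\mathcal{K}=\ker(\pi_*:L^1X\to L^1H)\subset\mathrm{d}B.X$; (2) $H$ has a normalised left integral. Then the inclusion $\iota:B=X^{\mathrm{co}H}\to X$ is a differential fibration, where the coaction is $\rho=(\mathrm{id}\otimes\pi)\Delta_X:X\to X\otimes H$ and $B$ has the differential structure $\Omega^1B=B.\mathrm{d}B\subset\Omega^1X$, $\Omega^nB=\bigwedge^n\Omega^1B\subset\Omega^nX$, which under $\Omega^nX\cong(L^1X)^{\wedge n}\otimes X$ is $\Omega^nB=(\mathcal{K}^{\wedge n}\otimes X)^{\mathrm{co}H}$.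
   Context: Algebras are unital over a field $k$; Hopf algebras have bijective antipode $S$; $\Delta x=x_{(1)}\otimes x_{(2)}$. A differential calculus on $A$ is a differential graded algebra $(\mathrm{d},\Omega^*A)$ with $\Omega^0A=A$, product $\wedge$, satisfying $\Omega^{n+1}A\subset A.\mathrm{d}\Omega^nA$. An algebra map is differentiable if it extends to a map (subscript $*$) of differential graded algebras; $\Omega^*(A\otimes C)=\Omega^*A\otimes\Omega^*C$ is the graded tensor product. Bicovariant means that the coproduct is differentiable, with higher forms given by Woronowicz's construction below. The left coaction $\xi\mapsto\xi_{[-1]}\otimes\xi_{[0]}\in X\otimes\Omega^nX$ and right coaction $\xi\mapsto\xi_{[0]}\otimes\xi_{[1]}\in\Omega^nX\otimes X$ are the components of $\Delta_*$ in these spaces. $L^1X=\{\xi\in\Omega^1X:\xi_{[-1]}\otimes\xi_{[0]}=1\otimes\xi\}$ (similarly $L^1H$). $X$ acts on $L^1X$ by $x\triangleright\eta=x_{(2)}\,\eta\,S^{-1}(x_{(1)})$. The braiding is $\sigma(\xi\otimes\eta)=\eta_{[0]}\otimes S(\eta_{[1]})\triangleright\xi$, and $(L^1X)^{\wedge n}$ is the quotient of $(L^1X)^{\otimes n}$ by the span of elements lying in $\ker(\sigma-\mathrm{id})$ in some pair of adjacent tensor factors. By definition $\Omega^nX\cong(L^1X)^{\wedge n}\otimes X$ (inverse of $\xi\otimes x\mapsto\xi x$), with $(\xi\otimes x)\wedge(\eta\otimes y)=\xi\wedge(x_{(2)}\triangleright\eta)\otimes x_{(1)}y$; similarly for $H$.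 $X^{\mathrm{co}H}=\{b\in X:\rho(b)=b\otimes1_H\}$. $\mathcal{K}^{\wedge n}\subset(L^1X)^{\wedge n}$ is the span of $n$-fold wedge products of elements of $\mathcal{K}$; the $H$-coaction on $L^1X$ is $\xi\mapsto\xi_{[0]}\otimes\pi(\xi_{[1]})$, and $\mathcal{K}^{\wedge n}\otimes X$ has the tensor product coaction. A normalised left integral on $H$ is a linear map $\int:H\to k$ with $(\mathrm{id}\otimes\int)\Delta_H=1_H.\int$ and $\int1_H=1$. Differential fibration: for a differentiable map $\iota:B\to X$ set $\Xi_m^0X=\iota_*\Omega^mB.X$ and, for $n>0$, $\Xi_m^nX=\dfrac{\iota_*\Omega^mB\wedge\Omega^nX}{\iota_*\Omega^{m+1}B\wedge\Omega^{n-1}X}$ (products mean linear spans of products), with quotient maps $[\,\cdot\,]_m$ and left $B$-action $b.\xi=\iota(b)\xi$. Then $\iota$ is a differential fibration if $\Theta_m:\Omega^mB\otimes_B\Xi_0^nX\to\Xi_m^nX$, $\Theta_m(\omega\otimes[\xi]_0)=[\iota_*\omega\wedge\xi]_m$, is invertible for all $m,n\ge0$. *)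

(* Defs.v *)
From HB Require Import structures.
From mathcomp Require Import all_boot all_algebra.
From mathcomp Require Import boolp classical_sets cardinality fsbigop.
From mathcomp Require Import freeg.

Set Implicit Arguments.
Unset Strict Implicit.
Unset Printing Implicit Defensive.

Import GRing.Theory.
Local Open Scope ring_scope.
Local Open Scope quotient_scope.
Local Open Scope classical_set_scope.

Section Span.
Variables (k : fieldType) (V : lmodType k) (S : set V).

Inductive lin_comb : set V :=
| lin_comb0 : lin_comb 0
| lin_combD a u v : S u -> lin_comb v -> lin_comb (a *: u + v).

Definition lspan : {pred V} := fun v => `[< lin_comb v >].

Lemma lspanP v : reflect (lin_comb v) (v \in lspan).
Proof. exact: asboolP. Qed.

Lemma lspan_submod_closed : submod_closed lspan.
Proof.
split=> [|a u v /lspanP hu /lspanP hv]; apply/lspanP; first exact: lin_comb0.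
elim: hu => [|b u1 u2 Su1 _ IH]; first by rewrite scaler0 add0r.
by rewrite scalerDr scalerA -addrA; apply: lin_combD.
Qed.

HB.instance Definition _ :=
  GRing.isSubmodClosed.Build k V lspan lspan_submod_closed.

Lemma sub_lspan v : S v -> v \in lspan.
Proof.
move=> Sv; apply/lspanP; rewrite -[v]scale1r -[_ *: _]addr0.
exact: lin_combD Sv lin_comb0.
Qed.

(* The span of S as a vector space, and the quotient of V by the span of S.    *)
Record lsub := LSub { lsub_val : V; _ : lsub_val \in lspan }.
HB.instance Definition _ := [isSub for lsub_val].
HB.instance Definition _ := [Choice of lsub by <:].
HB.instance Definition _ := [SubChoice_isSubLmodule of lsub by <:].

Definition lquot := Quotient.quot lspan.
HB.instance Definition _ := GRing.Zmodule.on lquot.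
HB.instance Definition _ : EqQuotient V (Quotient.equiv lspan) lquot :=
  EqQuotient.on lquot.

Definition lclass (v : V) : lquot := \pi_lquot v.
Definition lquot_scale (a : k) (q : lquot) : lquot := lclass (a *: repr q).

Lemma lclass_eq u v : (lclass u == lclass v) = (u - v \in lspan).
Proof. by rewrite Quotient.idealrBE. Qed.

Lemma lclass_reprK q : lclass (repr q) = q.
Proof. exact: reprK. Qed.

Lemma lclassD u v : lclass (u + v) = lclass u + lclass v.
Proof. by rewrite /lclass !piE. Qed.

Lemma lclass_scale a v : lclass (a *: v) = lquot_scale a (lclass v).
Proof.
apply/eqP; rewrite lclass_eq -scalerBr rpredZ // -lclass_eq.
by rewrite lclass_reprK.
Qed.

Lemma lquot_scaleA a b q :
  lquot_scale a (lquot_scale b q) = lquot_scale (a * b) q.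
Proof. by rewrite -[q]lclass_reprK -!lclass_scale scalerA. Qed.

Lemma lquot_scale1 : left_id 1 lquot_scale.
Proof. by move=> q; rewrite -[q]lclass_reprK -lclass_scale scale1r. Qed.

Lemma lquot_scaleDr : right_distributive lquot_scale +%R.
Proof.
move=> a p q; rewrite -[p]lclass_reprK -[q]lclass_reprK.
by rewrite -lclassD -!lclass_scale -lclassD scalerDr.
Qed.

Lemma lquot_scaleDl q : {morph lquot_scale^~ q : a b / a + b}.
Proof.
by move=> a b; rewrite -[q]lclass_reprK -!lclass_scale -lclassD scalerDl.
Qed.

HB.instance Definition _ := GRing.Zmodule_isLmodule.Build k lquot
  lquot_scaleA lquot_scale1 lquot_scaleDr lquot_scaleDl.

Lemma lclass_linear : linear lclass.
Proof. by move=> a u v; rewrite lclassD lclass_scale. Qed.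

HB.instance Definition _ :=
  GRing.isLinear.Build k V lquot *:%R lclass lclass_linear.

(* The map induced on the quotient by a linear map that vanishes on S. *)
Definition qlift (Z : Type) (f : V -> Z) (q : lquot) : Z := f (repr q).

Lemma qliftE (Z : lmodType k) (f : {linear V -> Z}) :
  (forall v, S v -> f v = 0) -> forall v, qlift f (lclass v) = f v.
Proof.
move=> f0 v; apply/eqP; rewrite -subr_eq0 -linearB; apply/eqP.
have /lspanP : repr (lclass v) - v \in lspan by rewrite -lclass_eq lclass_reprK.
by elim=> [|a u w Su _ IH]; rewrite ?linear0 // linearP f0 // scaler0 add0r.
Qed.

End Span.

Arguments lclass {k V} S v.
Arguments qlift {k V S Z} f q.

(* Tensor product over k: the free vector space on V * W modulo the           *)
(* bilinearity relations.                                                     *)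
Section Tensor.
Variables (k : fieldType) (V W : lmodType k).

Local Notation free_pair v w :=
  (Freeg [:: (1 : k, (v, w))] : {freeg (V * W)%type / k}).

Inductive bilin_rel : set {freeg (V * W)%type / k} :=
| bilin_rel_l a v v' w : bilin_rel
    (free_pair (a *: v + v') w - (a *: free_pair v w + free_pair v' w))
| bilin_rel_r a v w w' : bilin_rel
    (free_pair v (a *: w + w') - (a *: free_pair v w + free_pair v w')).

Definition tensor := lquot bilin_rel.
HB.instance Definition _ := GRing.Lmodule.on tensor.

Definition tmk (v : V) (w : W) : tensor := lclass bilin_rel (free_pair v w).

(* The linear map on the tensor product induced by a bilinear map f. *)
Definition tlift (Z : lmodType k) (f : V -> W -> Z) : tensor -> Z :=
  qlift (fglift (fun p => f p.1 p.2)).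

Definition bilinear_map (Z : lmodType k) (f : V -> W -> Z) :=
  (forall w, linear (f^~ w)) /\ (forall v, linear (f v)).

Lemma tmk_bilinear : bilinear_map tmk.
Proof.
split=> [w a v v'|v a w w'] /=; rewrite /tmk -linearP; apply/eqP;
  rewrite lclass_eq; apply: sub_lspan; [exact: bilin_rel_l|exact: bilin_rel_r].
Qed.

Lemma fglift_is_linear (Z : lmodType k) (f : (V * W)%type -> Z) :
  linear (fglift f).
Proof.
move=> a D1 D2.
have fgliftB D D' : fglift f (D - D') = fglift f D - fglift f D'.
  exact: lift_is_additive.
have fglift0 : fglift f 0 = 0 by rewrite -(subrr (0 : {freeg (V * W)%type / k})) fgliftB subrr.
have fgliftN D : fglift f (- D) = - fglift f D by rewrite -sub0r fgliftB fglift0 sub0r.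
have fgliftD D D' : fglift f (D + D') = fglift f D + fglift f D'.
  by rewrite -{1}[D']opprK fgliftB fgliftN opprK.
have fglift_sum (r : seq (V * W)%type) F :
    fglift f (\sum_(x <- r) F x) = \sum_(x <- r) fglift f (F x).
  by elim: r => [|x r IH]; rewrite ?big_nil // !big_cons fgliftD IH.
rewrite fgliftD; congr (_ + _).
have -> : fglift f D1 = \sum_(x <- dom D1) coeff x D1 *: f x.
  rewrite -{1}(freeg_sumE D1) fglift_sum.
  by apply: eq_bigr => x _; rewrite liftU.
rewrite scaler_sumr [a *: D1]/(fgscale a D1) fglift_sum.
by apply: eq_bigr => x _; rewrite liftU scalerA.
Qed.

Lemma tlift_tmk_linear (Z : lmodType k) (f : V -> W -> Z) : bilinear_map f ->
  linear (tlift f) /\ forall v w, tlift f (tmk v w) = f v w.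
Proof.
move=> [fl fr].
pose g : {linear {freeg (V * W)%type / k} -> Z} :=
  HB.pack (fglift (fun p : (V * W)%type => f p.1 p.2))
    (GRing.isLinear.Build _ _ _ _ _ (fglift_is_linear (fun p : (V * W)%type => f p.1 p.2))).
have gU v w : g (free_pair v w) = f v w by rewrite /g /= liftU scale1r.
have g0 t : bilin_rel t -> g t = 0.
  case=> [a v v' w|a v w w']; rewrite linearB linearP !gU.
    by rewrite (fl w) subrr.
  by rewrite (fr v) subrr.
split=> [a s t|v w]; last by rewrite /tlift /tmk (qliftE g0).
rewrite -[s]lclass_reprK -[t]lclass_reprK -linearP.
by rewrite /tlift !(qliftE g0) linearP.
Qed.

Lemma tlift_linear (Z : lmodType k) (f : V -> W -> Z) :
  bilinear_map f -> linear (tlift f).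
Proof. by case/tlift_tmk_linear. Qed.

Lemma tliftE (Z : lmodType k) (f : V -> W -> Z) :
  bilinear_map f -> forall v w, tlift f (tmk v w) = f v w.
Proof. by case/tlift_tmk_linear. Qed.

Lemma tmkDl w : {morph tmk^~ w : v v' / v + v'}.
Proof. by move=> v v'; have := tmk_bilinear.1 w 1 v v'; rewrite !scale1r. Qed.

Lemma tmkDr v : {morph tmk v : w w' / w + w'}.
Proof. by move=> w w'; have := tmk_bilinear.2 v 1 w w'; rewrite !scale1r. Qed.

Lemma tmk0l w : tmk 0 w = 0.
Proof. by apply: (addIr (tmk 0 w)); rewrite -tmkDl !add0r. Qed.

Lemma tmk0r v : tmk v 0 = 0.
Proof. by apply: (addIr (tmk v 0)); rewrite -tmkDr !add0r. Qed.

Lemma tmkZl a v w : tmk (a *: v) w = a *: tmk v w.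
Proof. by have := tmk_bilinear.1 w a v 0; rewrite tmk0l !addr0. Qed.

Lemma tmkZr a v w : tmk v (a *: w) = a *: tmk v w.
Proof. by have := tmk_bilinear.2 v a w 0; rewrite tmk0r !addr0. Qed.

Lemma tensor_ind (P : tensor -> Prop) :
  P 0 -> (forall v w t, P t -> P (tmk v w + t)) -> forall t, P t.
Proof.
move=> P0 PD t; rewrite -[t]lclass_reprK -[repr t]freeg_sumE.
rewrite (linear_sum (lclass bilin_rel)) /=.
elim: (dom _) => [|[v w] r IH]; rewrite ?big_nil // big_cons.
set c := coeff _ _.
have -> : lclass bilin_rel [freeg [:: (c, (v, w))]] = tmk (c *: v) w; last exact: PD.
rewrite tmkZl /tmk -linearZ /=; congr lclass.
apply/eqP/freeg_eqP => x; rewrite coeffZ !coeffU mul1r.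
by rewrite ?mulrA ?mulr1.
Qed.

End Tensor.

Arguments tensor {k} (V W)%_type_scope.

Notation "V ⊗ W" := (tensor V W) (at level 40, left associativity) : type_scope.
Notation "v ⊗ w" := (tmk v w) (at level 40, left associativity) : ring_scope.

Section TensorMaps.
Variable k : fieldType.

Definition tmap (V V' W W' : lmodType k) (f : V -> V') (g : W -> W') :
    V ⊗ W -> V' ⊗ W' :=
  tlift (fun v w => f v ⊗ g w).

Section TmapLinear.
Variables (V V' W W' : lmodType k) (f : {linear V -> V'}) (g : {linear W -> W'}).

Lemma tmap_bilinear : bilinear_map (fun v w => f v ⊗ g w).
Proof.
by split=> [w a v v'|v a w w'] /=; rewrite linearP ?tmkDl ?tmkDr ?tmkZl ?tmkZr.
Qed.

HB.instance Definition _ := GRing.isLinear.Build k (V ⊗ W)%type (V' ⊗ W')%type *:%R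
  (tmap f g) (tlift_linear tmap_bilinear).

Lemma tmapE v w : tmap f g (v ⊗ w) = f v ⊗ g w.
Proof. exact: (tliftE tmap_bilinear). Qed.

End TmapLinear.

Definition tassoc (U V W : lmodType k) : (U ⊗ V) ⊗ W -> U ⊗ (V ⊗ W) :=
  tlift (fun s w => tlift (fun u v => u ⊗ (v ⊗ w)) s).

(* The product of the tensor product of two (ungraded) algebras. *)
Definition tmul (A C : algType k) (s t : A ⊗ C) : A ⊗ C :=
  tlift (fun a c => tlift (fun a' c' => (a * a') ⊗ (c * c')) t) s.

Lemma tmul_pure_bilinear (A C : algType k) (a : A) (c : C) :
  bilinear_map (fun (a' : A) (c' : C) => (a * a') ⊗ (c * c')).
Proof.
split=> [c' u x y|a' u x y] /=.
  by rewrite mulrDr -scalerAr tmkDl tmkZl.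
by rewrite mulrDr -scalerAr tmkDr tmkZr.
Qed.

Lemma tmul_bilinear_l (A C : algType k) (t : A ⊗ C) : bilinear_map
  (fun a c => tlift (fun (a' : A) (c' : C) => (a * a') ⊗ (c * c')) t).
Proof.
pose L (a : A) (c : C) := tlift_linear (tmul_pure_bilinear a c).
have LD a c s s' : tlift (fun a' c' => (a * a') ⊗ (c * c')) (s + s') =
    tlift (fun a' c' => (a * a') ⊗ (c * c')) s +
    tlift (fun a' c' => (a * a') ⊗ (c * c')) s' :> A ⊗ C.
  by have := L a c 1 s s'; rewrite !scale1r.
have L0 a c : tlift (fun a' c' => (a * a') ⊗ (c * c')) 0 = 0 :> A ⊗ C.
  by apply: (addIr (tlift (fun a' c' => (a * a') ⊗ (c * c')) 0)); rewrite -LD !add0r.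
split=> [c u x y|a u x y] /=; elim/tensor_ind: t => [|a' c' t IH];
  rewrite ?L0 ?scaler0 ?addr0 // !LD IH !(tliftE (tmul_pure_bilinear _ _));
  by rewrite mulrDl -scalerAl ?tmkDl ?tmkDr ?tmkZl ?tmkZr scalerDr addrACA.
Qed.

Lemma tmul_linear_l (A C : algType k) (t : A ⊗ C) : linear (@tmul A C ^~ t).
Proof. exact: tlift_linear (tmul_bilinear_l t). Qed.

Lemma tmul_linear_r (A C : algType k) (s : A ⊗ C) : linear (tmul s).
Proof.
move=> u t t'; elim/tensor_ind: s => [|a c s IH].
  have t0 t1 : tmul 0 t1 = 0 :> A ⊗ C.
    by have := tmul_linear_l t1 (-1) 0 0; rewrite scaleN1r oppr0 addr0 scaleN1r addNr.
  by rewrite !t0 scaler0 addr0.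
have tD t1 : tmul (a ⊗ c + s) t1 = tmul (a ⊗ c) t1 + tmul s t1.
  by have := tmul_linear_l t1 1 (a ⊗ c) s; rewrite !scale1r.
rewrite !tD IH /tmul !(tliftE (tmul_bilinear_l _)).
by rewrite (tlift_linear (tmul_pure_bilinear a c)) scalerDr addrACA.
Qed.

Lemma tmulE (A C : algType k) (a a' : A) (c c' : C) :
  tmul (a ⊗ c) (a' ⊗ c') = (a * a') ⊗ (c * c').
Proof.
by rewrite /tmul (tliftE (tmul_bilinear_l _)) (tliftE (tmul_pure_bilinear _ _)).
Qed.

Lemma tmap_tmul (A A' C C' : algType k) (f : {lrmorphism A -> A'})
    (g : {lrmorphism C -> C'}) (s t : A ⊗ C) :
  tmap f g (tmul s t) = tmul (tmap f g s) (tmap f g t).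
Proof.
have lin_sum (U Z : lmodType k) (h : U -> Z) : linear h -> h 0 = 0 /\ {morph h : u v / u + v}.
  move=> hl; split; first by have := hl (-1) 0 0; rewrite scaleN1r oppr0 addr0 scaleN1r addNr.
  by move=> u v; have := hl 1 u v; rewrite !scale1r.
elim/tensor_ind: s => [|a c s IH].
  by rewrite !linear0 !(lin_sum _ _ _ (tmul_linear_l _)).1 linear0.
rewrite (lin_sum _ _ _ (tmul_linear_l _)).2 !linearD.
rewrite (lin_sum _ _ _ (tmul_linear_l _)).2 /= IH; congr (_ + _).
elim/tensor_ind: t {IH} => [|a' c' t IH].
  by rewrite !linear0 !(lin_sum _ _ _ (tmul_linear_r _)).1 linear0.
rewrite (lin_sum _ _ _ (tmul_linear_r _)).2 !linearD.
rewrite (lin_sum _ _ _ (tmul_linear_r _)).2 /= IH; congr (_ + _).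
by rewrite tmulE !tmapE tmulE !rmorphM.
Qed.

Fixpoint tpow (V : lmodType k) (n : nat) : lmodType k :=
  if n is n'.+1 then (V ⊗ tpow V n')%type : lmodType k else k^o.

(* The pure tensors in the n-th tensor power of V with all factors in S. *)
Fixpoint tpow_pure (V : lmodType k) (S : set V) (n : nat) : set (tpow V n) :=
  match n return set (tpow V n) with
  | 0 => [set (1 : k^o)]
  | n'.+1 => [set v ⊗ t | v in S & t in @tpow_pure V S n']
  end.

(* The diagonal right coaction of an algebra C on V ⊗ W. *)
Definition tcoact (V W : lmodType k) (C : algType k)
    (f : V -> V ⊗ C) (g : W -> W ⊗ C) : V ⊗ W -> (V ⊗ W) ⊗ C :=
  tlift (fun v w =>
    tlift (fun v0 c => tlift (fun w0 c' => (v0 ⊗ w0) ⊗ (c * c')) (g w)) (f v)).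

Fixpoint tpow_coact (V : lmodType k) (C : algType k) (f : V -> V ⊗ C)
    (n : nat) : tpow V n -> tpow V n ⊗ C :=
  match n return tpow V n -> tpow V n ⊗ C with
  | 0 => fun a : k^o => a ⊗ 1
  | n'.+1 => tcoact f (@tpow_coact V C f n')
  end.

End TensorMaps.

Arguments tpow_pure {k V} S n _.

Record hopfAlg (k : fieldType) := HopfAlg {
  hopf_alg :> algType k;
  comul : {linear hopf_alg -> (hopf_alg ⊗ hopf_alg)%type};
  counit : {lrmorphism hopf_alg -> k^o};
  antipode : {linear hopf_alg -> hopf_alg};
  antipode_inv : hopf_alg -> hopf_alg;
  comul1 : comul 1 = 1 ⊗ 1;
  comulM : forall x y, comul (x * y) = tmul (comul x) (comul y);
  comulA : forall x,
    tassoc (tmap comul idfun (comul x)) = tmap idfun comul (comul x);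
  counitl : forall x, tlift (fun y z => counit y *: z) (comul x) = x;
  counitr : forall x, tlift (fun y z => counit z *: y) (comul x) = x;
  antipodel : forall x,
    tlift (fun y z => antipode y * z) (comul x) = (counit x)%:A;
  antipoder : forall x,
    tlift (fun y z => y * antipode z) (comul x) = (counit x)%:A;
  antipodeK : cancel antipode antipode_inv;
  antipode_invK : cancel antipode_inv antipode
}.

(* The data underlying a differential graded algebra; pcomp n is the          *)
(* projection onto the homogeneous component of degree n.                     *)
Record dga_data (k : fieldType) := DgaData {
  pcar :> lmodType k;
  pone : pcar;
  pmul : pcar -> pcar -> pcar;
  pcomp : nat -> pcar -> pcar;
  pd : pcar -> pcar
}.

Arguments pone {k d}.
Arguments pmul {k d}.
Arguments pcomp {k d}.
Arguments pd {k d}.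

Section Dga.
Variable k : fieldType.

(* Multiplies each homogeneous component of degree q by (-1)^(p * q). *)
Definition koszul (D : dga_data k) (p : nat) (w : D) : D :=
  \sum_(q \in [set: nat]) (-1) ^+ (p * q) *: pcomp q w.

(* The graded tensor product: (w ⊗ z)(w' ⊗ z') = (-1)^(|z||w'|) ww' ⊗ zz' and *)
(* d(w ⊗ z) = dw ⊗ z + (-1)^|w| w ⊗ dz.                                       *)
Definition tensor_dga (D1 D2 : dga_data k) : dga_data k := {|
  pcar := (D1 ⊗ D2)%type;
  pone := pone ⊗ pone;
  pmul := fun s t =>
    tlift (fun w z => tlift (fun w' z' =>
      \sum_(p \in [set: nat])
        pmul w (koszul p w') ⊗ pmul (pcomp p z) z') t) s;
  pcomp := fun n t => \sum_(i < n.+1) tmap (pcomp i) (pcomp (n - i)%N) t;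
  pd := tlift (fun w z => pd w ⊗ z + koszul 1 w ⊗ pd z)
|}.

Record dga_map (D1 D2 : dga_data k) := DgaMap {
  dga_fun :> {linear D1 -> D2};
  dga_map1 : dga_fun pone = pone;
  dga_mapM : forall w z, dga_fun (pmul w z) = pmul (dga_fun w) (dga_fun z);
  dga_map_comp : forall n w, dga_fun (pcomp n w) = pcomp n (dga_fun w);
  dga_map_d : forall w, dga_fun (pd w) = pd (dga_fun w)
}.

(* A differential calculus on A. All degrees are collected in one algebra;    *)
(* fcomp n projects onto the forms of degree n, and finc identifies A with    *)
(* the forms of degree 0.                                                     *)
Record calculus (A : algType k) := Calculus {
  form :> algType k;
  fcomp : nat -> {linear form -> form};
  fd : {linear form -> form};
  finc : {lrmorphism A -> form};
  fcompK : forall m n w, fcomp m (fcomp n w) = if m == n then fcomp n w else 0;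
  fcomp_finite : forall w, finite_set [set n | fcomp n w != 0];
  fcomp_sum : forall w, w = \sum_(n \in [set: nat]) fcomp n w;
  fmul_deg : forall m n w z, fcomp m w = w -> fcomp n z = z ->
    fcomp (m + n)%N (w * z) = w * z;
  fd_deg : forall n w, fcomp n w = w -> fcomp n.+1 (fd w) = fd w;
  fd_d : forall w, fd (fd w) = 0;
  fd_leibniz : forall n w z, fcomp n w = w ->
    fd (w * z) = fd w * z + (-1) ^+ n *: (w * fd z);
  finc_inj : injective finc;
  finc_deg : forall w, fcomp 0 w = w <-> exists a, w = finc a;
  fgen : forall n w, fcomp n.+1 w = w ->
    lin_comb [set finc a * fd z | a in [set: A] &
                                  z in [set z | fcomp n z = z]] w
}.

Definition dga_of (A : algType k) (OA : calculus A) : dga_data k := {|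
  pcar := OA;
  pone := 1;
  pmul := *%R;
  pcomp := fun n => fcomp OA n;
  pd := fd OA
|}.

Definition formn (A : algType k) (OA : calculus A) (n : nat) : set OA :=
  [set w | fcomp OA n w = w].

Arguments formn {A} OA n _.

Record diff_map (A C : algType k) (OA : calculus A) (OC : calculus C) :=
  DiffMap {
    dm_alg :> {lrmorphism A -> C};
    dm_form : dga_map (dga_of OA) (dga_of OC);
    dm_ext : forall a, dm_form (finc OA a) = finc OC (dm_alg a)
  }.

Lemma fbase_subproof (A : algType k) (OA : calculus A) (w : OA) :
  exists a, fcomp OA 0 w == finc OA a.
Proof.
have /finc_deg[a ->] : fcomp OA 0 (fcomp OA 0 w) = fcomp OA 0 w.
  by rewrite fcompK.
by exists a.
Qed.

(* The degree 0 component of a form, as an element of A. *)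
Definition fbase (A : algType k) (OA : calculus A) (w : OA) : A :=
  xchoose (fbase_subproof w).

Lemma fbaseE (A : algType k) (OA : calculus A) (w : OA) :
  finc OA (fbase w) = fcomp OA 0 w.
Proof. by apply/esym/eqP; exact: (xchooseP (fbase_subproof w)). Qed.

End Dga.

Arguments formn {k A} OA n _.

Section Bicovariant.
Variables (k : fieldType) (X : hopfAlg k).

Record comul_diff := ComulDiff {
  cd_calc :> calculus X;
  cd_comul : dga_map (dga_of cd_calc) (tensor_dga (dga_of cd_calc) (dga_of cd_calc));
  cd_ext : forall x, cd_comul (finc cd_calc x) =
    tmap (finc cd_calc) (finc cd_calc) (comul X x)
}.

Variable OX : comul_diff.

Definition lcoact (w : OX) : X ⊗ OX := tmap (@fbase k X OX) idfun (cd_comul OX w).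
Definition rcoact (w : OX) : OX ⊗ X := tmap idfun (@fbase k X OX) (cd_comul OX w).

Definition act (x : X) (w : OX) : OX :=
  tlift (fun x1 x2 => finc OX x2 * w * finc OX (antipode_inv x1)) (comul X x).

(* The left-invariant 1-forms; they already form a subspace of OX.            *)
Definition L1 := lsub [set w : OX | formn OX 1 w /\ lcoact w = 1 ⊗ w].

(* The right coaction and the action preserve the subspace L1 of OX, and      *)
(* L1 ⊗ X -> OX ⊗ X is injective; the following are the restrictions to L1.   *)
Definition L1_coact (xi : L1) : L1 ⊗ X :=
  xget 0 [set t | tmap (val : L1 -> OX) idfun t = rcoact (val xi)].
Definition L1_act (x : X) (xi : L1) : L1 := insubd 0 (act x (val xi)).

Definition braiding : L1 ⊗ L1 -> L1 ⊗ L1 :=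
  tlift (fun xi eta =>
    tlift (fun eta0 eta1 => eta0 ⊗ L1_act (antipode X eta1) xi) (L1_coact eta)).

Inductive braid_rel : forall n, tpow L1 n -> Prop :=
| braid_rel_here n (t : L1 ⊗ L1) (u : tpow L1 n) :
    braiding t = t -> @braid_rel n.+2 (tassoc (t ⊗ u))
| braid_rel_next n (xi : L1) (u : tpow L1 n) :
    @braid_rel n u -> @braid_rel n.+1 (xi ⊗ u).

Definition wedge (n : nat) := lquot (@braid_rel n).

Fixpoint wedge_prod (n : nat) : tpow L1 n -> OX :=
  match n return tpow L1 n -> OX with
  | 0 => fun a : k^o => a%:A
  | n'.+1 => tlift (fun xi t => val xi * @wedge_prod n' t)
  end.

Definition wedge_form (n : nat) : wedge n ⊗ X -> OX :=
  tlift (fun q x => qlift (@wedge_prod n) q * finc OX x).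

Definition woronowicz := forall n,
  [/\ forall t, @braid_rel n t -> wedge_prod t = 0,
      injective (@wedge_form n)
    & range (@wedge_form n) = formn OX n].

End Bicovariant.

Section Subalgebra.
Variables (k : fieldType) (A : algType k) (S : subalgClosed A).

Record subalg := SubAlg { subalg_val : A; _ : subalg_val \in S }.
HB.instance Definition _ := [isSub for subalg_val].
HB.instance Definition _ := [Choice of subalg by <:].
HB.instance Definition _ := [SubChoice_isSubAlgebra of subalg by <:].

Definition subalg_incl (a : subalg) : A := val a.

Lemma subalg_incl_linear : linear subalg_incl.
Proof. by []. Qed.
HB.instance Definition _ :=
  GRing.isLinear.Build k subalg A *:%R subalg_incl subalg_incl_linear.

Lemma subalg_incl_monoid_morphism : monoid_morphism subalg_incl.
Proof. by []. Qed.
HB.instance Definition _ :=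
  GRing.isMonoidMorphism.Build subalg A subalg_incl subalg_incl_monoid_morphism.

End Subalgebra.

Section SubCalculus.
Variables (k : fieldType) (A : algType k) (OA : calculus A) (S : subalgClosed A).

Local Notation fcomp := (fcomp OA).
Local Notation fd := (fd OA).
Local Notation finc := (finc OA).

Definition sub_form1 : set OA :=
  lin_comb [set finc b * fd (finc b') | b in [set b | b \in S] &
                                        b' in [set b' | b' \in S]].

Fixpoint sub_formn (n : nat) : set OA :=
  match n with
  | 0 => [set finc b | b in [set b | b \in S]]
  | n'.+1 => lin_comb [set w * z | w in sub_formn n' & z in sub_form1]
  end.

Definition sub_form : {pred OA} :=
  fun w => `[< forall n, sub_formn n (fcomp n w) >].

Definition sub_formn_gen n : set OA :=
  lin_comb [set finc b * fd z | b in [set b | b \in S] & z in sub_formn n].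

Lemma lin_comb_le (V : lmodType k) (P : set V) (Q : V -> Prop) :
  (forall u, P u -> Q u) -> Q 0 -> (forall a u w, Q u -> Q w -> Q (a *: u + w)) ->
  forall v, lin_comb P v -> Q v.
Proof. by move=> PQ Q0 QD v; elim=> // a u w /PQ Qu _; exact: QD. Qed.

Lemma lin_comb_lin (V : lmodType k) (P : set V) a u w :
  lin_comb P u -> lin_comb P w -> lin_comb P (a *: u + w).
Proof.
by move=> /lspanP Pu /lspanP Pw; apply/lspanP; rewrite rpredD // rpredZ.
Qed.

Lemma lin_comb_gen (V : lmodType k) (P : set V) u : P u -> lin_comb P u.
Proof. by move=> Pu; apply/lspanP; apply: sub_lspan. Qed.

Lemma sub_formn0 n : sub_formn n 0.
Proof.
case: n => [|n] /=; last exact: lin_comb0.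
by exists 0; [exact: rpred0|rewrite linear0].
Qed.

Lemma sub_formn_lin n a u w : sub_formn n u -> sub_formn n w ->
  sub_formn n (a *: u + w).
Proof.
case: n => [|n] /=; last exact: lin_comb_lin.
move=> [b Sb <-] [c Sc <-]; exists (a *: b + c); last by rewrite linearP.
by rewrite /= rpredD // rpredZ.
Qed.

Lemma sub_formnD n u w : sub_formn n u -> sub_formn n w -> sub_formn n (u + w).
Proof. by move=> nu nw; rewrite -[u]scale1r; exact: sub_formn_lin. Qed.

Lemma sub_formnZ n a u : sub_formn n u -> sub_formn n (a *: u).
Proof.
by rewrite -[_ *: _]addr0 => uS; apply: sub_formn_lin => //; exact: sub_formn0.
Qed.

Lemma sub_formnS n (P : OA -> Prop) :
  (forall u z, sub_formn n u -> sub_form1 z -> P (u * z)) ->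
  P 0 -> (forall a u z, P u -> P z -> P (a *: u + z)) ->
  forall w, sub_formn n.+1 w -> P w.
Proof.
move=> PM P0 PD; rewrite /=; apply: lin_comb_le => //.
by move=> _ [u Su [z Sz <-]]; apply: PM.
Qed.

Lemma sub_formn1M n u z : sub_formn n u -> sub_form1 z -> sub_formn n.+1 (u * z).
Proof. by move=> nu z1; apply: lin_comb_gen; exists u => //; exists z. Qed.

Lemma finc_deg0 a : fcomp 0 (finc a) = finc a.
Proof. by apply/finc_deg; exists a. Qed.

Lemma sub_form1_mulr z b : sub_form1 z -> b \in S -> sub_form1 (z * finc b).
Proof.
move=> z1 Sb; move: z z1; apply: lin_comb_le.
- move=> _ [b0 Sb0 [b1 Sb1 <-]].
  have -> : finc b0 * fd (finc b1) * finc b =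
      -1 *: (finc (b0 * b1) * fd (finc b)) + finc b0 * fd (finc (b1 * b)).
    rewrite !rmorphM (fd_leibniz _ (finc_deg0 b1)) expr0 scale1r mulrDr scaleN1r.
    by rewrite -!mulrA addrCA addNr addr0.
  apply: lin_comb_lin; apply: lin_comb_gen.
    by exists (b0 * b1); [rewrite /= rpredM|exists b].
  by exists b0 => //; exists (b1 * b) => //; rewrite /= rpredM.
- by rewrite mul0r; exact: lin_comb0.
- by move=> a u w ? ?; rewrite mulrDl -scalerAl; apply: lin_comb_lin.
Qed.

Lemma sub_formn_mulr n w b : sub_formn n w -> b \in S -> sub_formn n (w * finc b).
Proof.
case: n => [|n] nw Sb.
  by case: nw => c Sc <-; exists (c * b); rewrite ?rmorphM //= rpredM.
move: w nw; apply: sub_formnS.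
- by move=> u z nu z1; rewrite -mulrA; apply: sub_formn1M => //; apply: sub_form1_mulr.
- by rewrite mul0r; exact: sub_formn0.
- by move=> a u z ? ?; rewrite mulrDl -scalerAl; apply: sub_formn_lin.
Qed.

Lemma sub_formnM m n w z : sub_formn m w -> sub_formn n z -> sub_formn (m + n) (w * z).
Proof.
move=> mw; elim: n z => [|n IH] z.
  by case=> b Sb <-; rewrite addn0; exact: sub_formn_mulr.
rewrite addnS; move: z; apply: sub_formnS.
- by move=> u {}z nu z1; rewrite mulrA; apply: sub_formn1M => //; exact: IH.
- by rewrite mulr0; exact: sub_formn0.
- by move=> a u v ? ?; rewrite mulrDr -scalerAr; apply: sub_formn_lin.
Qed.

Lemma fcomp_lin_deg n a u w : fcomp n u = u -> fcomp n w = w ->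
  fcomp n (a *: u + w) = a *: u + w.
Proof. by move=> nu nw; rewrite linearP nu nw. Qed.

Lemma sub_form1_deg z : sub_form1 z -> fcomp 1 z = z.
Proof.
move: z; apply: lin_comb_le.
- move=> _ [b _ [c _ <-]]; apply: (@fmul_deg _ _ OA 0 1); first exact: finc_deg0.
  by apply: fd_deg; exact: finc_deg0.
- by rewrite linear0.
- by move=> *; apply: fcomp_lin_deg.
Qed.

Lemma sub_formn_deg n w : sub_formn n w -> fcomp n w = w.
Proof.
elim: n w => [|n IH] w; first by case=> b _ <-; exact: finc_deg0.
move: w; apply: sub_formnS.
- by move=> u z /IH nu /sub_form1_deg z1; rewrite -addn1; apply: fmul_deg.
- by rewrite linear0.
- by move=> *; apply: fcomp_lin_deg.
Qed.

Lemma finc1 : finc 1 = 1. Proof. exact: rmorph1. Qed.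

Lemma sub_form1_d b : b \in S -> sub_form1 (fd (finc b)).
Proof.
move=> Sb; apply: lin_comb_gen; exists 1; first exact: rpred1.
by exists b => //; rewrite finc1 mul1r.
Qed.

Lemma sub_form1_formn z : sub_form1 z -> sub_formn 1 z.
Proof.
move=> z1; rewrite -[z]mul1r -finc1; apply: sub_formn1M => //.
by exists 1 => //; exact: rpred1.
Qed.

Lemma sub_form1_dd z : sub_form1 z -> sub_formn 2 (fd z).
Proof.
move: z; apply: lin_comb_le.
- move=> _ [b Sb [c Sc <-]]; rewrite (fd_leibniz _ (finc_deg0 b)) fd_d mulr0.
  rewrite scaler0 addr0; apply: (@sub_formn1M 1); last exact: sub_form1_d.
  by apply: sub_form1_formn; exact: sub_form1_d.
- by rewrite linear0; exact: sub_formn0.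
- by move=> a u w ? ?; rewrite linearP; exact: sub_formn_lin.
Qed.

Lemma sub_formn_d n w : sub_formn n w -> sub_formn n.+1 (fd w).
Proof.
elim: n w => [|n IH] w.
  by case=> b Sb <-; apply: sub_form1_formn; exact: sub_form1_d.
move: w; apply: sub_formnS.
- move=> u z nu z1; rewrite (fd_leibniz _ (sub_formn_deg nu)); apply: sub_formnD.
    by apply: sub_formn1M => //; exact: IH.
  by apply: sub_formnZ; rewrite -addn2; apply: sub_formnM => //; exact: sub_form1_dd.
- by rewrite linear0; exact: sub_formn0.
- by move=> a u z ? ?; rewrite linearP; exact: sub_formn_lin.
Qed.

Lemma sub_formn_genP n w : sub_formn n.+1 w -> sub_formn_gen n w.
Proof.
elim: n w => [|n IH]; apply: sub_formnS;
  rewrite ?(mulr0, mul0r); try exact: lin_comb0;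
  try by move=> a u z ? ?; exact: lin_comb_lin.
- move=> _ z [b0 Sb0 <-]; move: z; apply: lin_comb_le.
  + move=> _ [b Sb [c Sc <-]]; apply: lin_comb_gen; exists (b0 * b).
      by rewrite /= rpredM.
    by exists (finc c); [exists c|rewrite rmorphM mulrA].
  + by rewrite mulr0; exact: lin_comb0.
  + by move=> a u v ? ?; rewrite mulrDr -scalerAr; exact: lin_comb_lin.
- move=> u z nu; move: z; apply: lin_comb_le.
  + move=> _ [b Sb [c Sc <-]]; rewrite mulrA.
    move: (u * finc b) (IH _ (sub_formn_mulr nu Sb)); apply: lin_comb_le.
    * move=> _ [b0 Sb0 [v nv <-]]; apply: lin_comb_gen; exists b0 => //.
      exists (v * fd (finc c)); first by apply: sub_formn1M => //; exact: sub_form1_d.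
      by rewrite (fd_leibniz _ (sub_formn_deg nv)) fd_d mulr0 scaler0 addr0 mulrA.
    * by rewrite mul0r; exact: lin_comb0.
    * by move=> a v1 v2 ? ?; rewrite mulrDl -scalerAl; exact: lin_comb_lin.
  + by rewrite mulr0; exact: lin_comb0.
  + by move=> a v1 v2 ? ?; rewrite mulrDr -scalerAr; exact: lin_comb_lin.
Qed.

Lemma fcomp_neq m n w : fcomp n w = w -> m != n -> fcomp m w = 0.
Proof. by move=> <- /negPf mn; rewrite fcompK mn. Qed.

Lemma finite_set_natP (P : set nat) : finite_set P ->
  exists N, forall n, (N <= n)%N -> ~ P n.
Proof.
move=> /finite_seqP[r ->]; exists (\max_(i <- r) i.+1) => n nN /= nr.
by have := leq_trans (@leq_bigmax_seq _ r xpredT succn n nr isT) nN; rewrite ltnn.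
Qed.

Lemma fsbig_nat_bound (V : lmodType k) (F : nat -> V) N :
  (forall n, (N <= n)%N -> F n = 0) ->
  \sum_(n \in [set: nat]) F n = \sum_(n < N) F n.
Proof.
move=> FN; rewrite fsbig_ord; apply/esym/fsbig_widen => // n [_ /= /negP].
by rewrite -leqNgt => /FN.
Qed.

Lemma fcomp_bound (w : OA) : exists2 N, forall n, (N <= n)%N -> fcomp n w = 0 &
  w = \sum_(n < N) fcomp n w.
Proof.
have [N HN] := finite_set_natP (fcomp_finite w).
have {}HN n : (N <= n)%N -> fcomp n w = 0.
  by move=> /HN /= /negP; rewrite negbK => /eqP.
by exists N => //; rewrite [LHS](fcomp_sum w); apply: fsbig_nat_bound.
Qed.

Lemma sub_form_subalg_closed : subalg_closed sub_form.
Proof.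
split=> [|a u v /asboolP Su /asboolP Sv|u v /asboolP Su /asboolP Sv];
  apply/asboolP => n.
- have h1 : fcomp 0 1 = 1 by rewrite -finc1; exact: finc_deg0.
  case: n => [|n]; first by rewrite h1 -finc1; exists 1 => //; exact: rpred1.
  by rewrite (fcomp_neq h1) //; exact: sub_formn0.
- by rewrite linearP; exact: sub_formn_lin.
- have [N _ ->] := fcomp_bound u; have [M _ ->] := fcomp_bound v.
  rewrite mulr_suml linear_sum /=.
  elim/big_ind: _ => [|? ? ? ?|i _]; [exact: sub_formn0|exact: sub_formnD|].
  rewrite mulr_sumr linear_sum /=.
  elim/big_ind: _ => [|? ? ? ?|j _]; [exact: sub_formn0|exact: sub_formnD|].
  have ij := sub_formnM (Su i) (Sv j).
  have [<-|nij] := eqVneq (i + j)%N n; first by rewrite (sub_formn_deg ij).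
  by rewrite (fcomp_neq (sub_formn_deg ij)) 1?eq_sym //; exact: sub_formn0.
Qed.

HB.instance Definition _ :=
  GRing.isSubalgClosed.Build k OA sub_form sub_form_subalg_closed.

Lemma sub_form_comp n w : w \in sub_form -> fcomp n w \in sub_form.
Proof.
move=> /asboolP Sw; apply/asboolP => m; rewrite fcompK.
by case: eqP => [->|_]; [exact: Sw|exact: sub_formn0].
Qed.

Lemma sub_formn_form n w : sub_formn n w -> w \in sub_form.
Proof.
move=> nw; apply/asboolP => m.
have [->|mn] := eqVneq m n; first by rewrite (sub_formn_deg nw).
by rewrite (fcomp_neq (sub_formn_deg nw) mn); exact: sub_formn0.
Qed.

Lemma sub_form_formn n w : w \in sub_form -> fcomp n w = w -> sub_formn n w.
Proof. by move=> /asboolP Sw nw; rewrite -nw; exact: Sw. Qed.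

Lemma sub_form_d w : w \in sub_form -> fd w \in sub_form.
Proof.
move=> /asboolP Sw; have [N _ ->] := fcomp_bound w.
rewrite linear_sum rpred_sum // => i _.
by apply: sub_formn_form; apply: sub_formn_d; exact: Sw.
Qed.

Lemma sub_form_inc b : b \in S -> finc b \in sub_form.
Proof. by move=> Sb; apply: (@sub_formn_form 0); exists b. Qed.

Local Notation B := (subalg S).
Local Notation OB := (subalg sub_form).

Definition scomp n (w : OB) : OB := SubAlg (sub_form_comp n (valP w)).
Definition sd (w : OB) : OB := SubAlg (sub_form_d (valP w)).
Definition sinc (b : B) : OB := SubAlg (sub_form_inc (valP b)).

Lemma scomp_linear n : linear (scomp n).
Proof. by move=> a u v; apply: val_inj; rewrite /= !linearP. Qed.
HB.instance Definition _ n :=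
  GRing.isLinear.Build k OB OB *:%R (scomp n) (scomp_linear n).

Lemma sd_linear : linear sd.
Proof. by move=> a u v; apply: val_inj; rewrite /= !linearP. Qed.
HB.instance Definition _ := GRing.isLinear.Build k OB OB *:%R sd sd_linear.

Lemma sinc_linear : linear sinc.
Proof. by move=> a u v; apply: val_inj; rewrite /= !linearP. Qed.
HB.instance Definition _ := GRing.isLinear.Build k B OB *:%R sinc sinc_linear.

Lemma sinc_monoid_morphism : monoid_morphism sinc.
Proof.
by split=> [|u v]; apply: val_inj; rewrite /= ?rmorph1 ?rmorphM.
Qed.
HB.instance Definition _ :=
  GRing.isMonoidMorphism.Build B OB sinc sinc_monoid_morphism.

Lemma scompK m n w : scomp m (scomp n w) = if m == n then scomp n w else 0.
Proof. by apply: val_inj; rewrite /= fcompK; case: ifP. Qed.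

Lemma scomp_finite w : finite_set [set n | scomp n w != 0].
Proof.
apply: sub_finite_set (fcomp_finite (val w)) => n /=.
by apply: contra => /eqP w0; apply/eqP/val_inj.
Qed.

Lemma scomp_sum w : w = \sum_(n \in [set: nat]) scomp n w.
Proof.
have [N wN w_sum] := fcomp_bound (val w).
rewrite (@fsbig_nat_bound _ (fun n => scomp n w) N).
  by apply: val_inj; rewrite linear_sum.
by move=> n /wN w0; apply: val_inj.
Qed.

Lemma scompP n w : scomp n w = w <-> fcomp n (val w) = val w.
Proof. by split=> [{2}<- //|w0]; apply: val_inj. Qed.

Lemma smul_deg m n w z : scomp m w = w -> scomp n z = z ->
  scomp (m + n)%N (w * z) = w * z.
Proof. by move=> /scompP mw /scompP nz; apply/scompP; exact: fmul_deg. Qed.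

Lemma sd_deg n w : scomp n w = w -> scomp n.+1 (sd w) = sd w.
Proof. by move=> /scompP nw; apply/scompP; exact: fd_deg. Qed.

Lemma sd_d w : sd (sd w) = 0.
Proof. by apply: val_inj; rewrite /= fd_d. Qed.

Lemma sd_leibniz n w z : scomp n w = w ->
  sd (w * z) = sd w * z + (-1) ^+ n *: (w * sd z).
Proof. by move=> /scompP nw; apply: val_inj; exact: fd_leibniz. Qed.

Lemma sinc_inj : injective sinc.
Proof. by move=> a b /(congr1 val) /= /finc_inj /val_inj. Qed.

Lemma sinc_deg w : scomp 0 w = w <-> exists a, w = sinc a.
Proof.
split=> [/scompP w0|[b ->]]; last by apply/scompP; exact: finc_deg0.
have [b Sb bw] := sub_form_formn (valP w) w0.
by exists (SubAlg Sb); apply: val_inj.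
Qed.

Lemma sgen n w : scomp n.+1 w = w ->
  lin_comb [set sinc b * sd z | b in [set: B] & z in [set z | scomp n z = z]] w.
Proof.
move=> /scompP w_deg.
have := sub_formn_genP (sub_form_formn (valP w) w_deg).
suff: forall v, sub_formn_gen n v -> exists2 u : OB, val u = v &
    lin_comb [set sinc b * sd z | b in [set: B] & z in [set z | scomp n z = z]] u.
  by move=> h /h[u /val_inj ->].
apply: lin_comb_le => [_ [b Sb [z nz <-]]||a _ _ [u <- Lu] [v <- Lv]].
- exists (sinc (SubAlg Sb) * sd (SubAlg (sub_formn_form nz))) => //.
  apply: lin_comb_gen; exists (SubAlg Sb) => //.
  exists (SubAlg (sub_formn_form nz)) => //.
  by apply/scompP; exact: sub_formn_deg nz.
- by exists 0 => //; exact: lin_comb0.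
- by exists (a *: u + v); [rewrite linearP|exact: lin_comb_lin].
Qed.

Definition sub_calculus : calculus B :=
  Calculus scompK scomp_finite scomp_sum smul_deg sd_deg sd_d sd_leibniz
    sinc_inj sinc_deg sgen.

Definition sub_inclusion_form : dga_map (dga_of sub_calculus) (dga_of OA) :=
  @DgaMap k (dga_of sub_calculus) (dga_of OA) (@subalg_incl k OA sub_form)
    erefl (fun _ _ => erefl) (fun _ _ => erefl) (fun _ => erefl).

Definition sub_inclusion : diff_map sub_calculus OA :=
  @DiffMap k B A sub_calculus OA (@subalg_incl k A S) sub_inclusion_form
    (fun _ => erefl).

End SubCalculus.

Section Fibration.
Variables (k : fieldType) (B X : algType k) (OB : calculus B) (OX : calculus X).
Variable iota : diff_map OB OX.

Definition Xi_num (m n : nat) : set OX :=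
  [set dm_form iota w * xi | w in formn OB m & xi in formn OX n].

Definition Xi_den (m n : nat) : set (lsub (Xi_num m n)) :=
  match n with
  | 0 => set0
  | n'.+1 => [set u | val u \in lspan (Xi_num m.+1 n')]
  end.

Definition Xi (m n : nat) := lquot (Xi_den (m := m) (n := n)).

(* The class of xi in Xi_m^n X, for xi in the span of Xi_num m n. *)
Definition Xi_class (m n : nat) (xi : OX) : Xi m n := lclass _ (insubd 0 xi).

(* The relations that define Omega^m B ⊗_B Xi_0^n X as a quotient of          *)
(* Omega^m B ⊗_k Xi_0^n X.                                                    *)
Definition balance_rel (m n : nat) : set (lsub (formn OB m) ⊗ Xi 0 n) :=
  [set t | exists (w wb : lsub (formn OB m)) (b : B) (xi : OX),
    [/\ val wb = val w * finc OB b, xi \in lspan (Xi_num 0 n)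
      & t = wb ⊗ Xi_class 0 n xi - w ⊗ Xi_class 0 n (finc OX (iota b) * xi)]].

Definition diff_fibration := forall m n,
  exists Theta : {linear lquot (@balance_rel m n) -> Xi m n},
    (forall w xi, xi \in lspan (Xi_num 0 n) ->
      Theta (lclass _ (w ⊗ Xi_class 0 n xi)) =
      Xi_class m n (dm_form iota (val w) * xi))
    /\ bijective Theta.

End Fibration.

(* A bicovariant differential structure: the coproduct is differentiable, and *)
(* ξ ⊗ x |-> ξ x is an isomorphism from (L1 X)^n ⊗ X onto the n-forms.        *)
Record bicovariant (k : fieldType) (X : hopfAlg k) := Bicovariant {
  bic_calc :> comul_diff X;
  bic_woronowicz : woronowicz bic_calc
}.

Definition hopf_map (k : fieldType) (X H : hopfAlg k) (f : X -> H) :=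
  (forall x, comul H (f x) = tmap f f (comul X x)) /\
  (forall x, counit H (f x) = counit X x).

Definition normalised_left_integral (k : fieldType) (H : hopfAlg k)
    (I : {linear H -> k^o}) :=
  (forall h, tlift (fun g g' => I g' *: g) (comul H h) = I h *: 1) /\ I 1 = 1.

Section HopfFibration.
Variables (k : fieldType) (X H : hopfAlg k).

Section Coinvariants.
Variable pi : {lrmorphism X -> H}.

Definition hcoact : X -> X ⊗ H := tmap idfun pi \o comul X.

Definition coinv : {pred X} := fun b => hcoact b == b ⊗ 1.

Lemma coinv_subalg_closed : subalg_closed coinv.
Proof.
have hcoactD a u v : hcoact (a *: u + v) = a *: hcoact u + hcoact v.
  by rewrite /hcoact /= !linearP.
have hcoact1 : hcoact 1 = 1 ⊗ 1 by rewrite /hcoact /= comul1 tmapE /= rmorph1.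
split=> [|a u v /eqP Su /eqP Sv|u v /eqP Su /eqP Sv]; apply/eqP.
- exact: hcoact1.
- by rewrite hcoactD Su Sv tmkDl tmkZl.
- have -> : hcoact (u * v) = tmul (hcoact u) (hcoact v).
    by rewrite /hcoact /= comulM (tmap_tmul idfun pi).
  by rewrite Su Sv tmulE mulr1.
Qed.

HB.instance Definition _ :=
  GRing.isSubalgClosed.Build k X coinv coinv_subalg_closed.

End Coinvariants.

Variables (OX : bicovariant X) (OH : bicovariant H) (pi : diff_map OX OH).

Definition ker_pi : set (L1 OX) := [set xi | dm_form pi (val xi) = 0].

Definition conditionK := forall xi : L1 OX, ker_pi xi ->
  val xi \in lspan [set fd OX (finc OX b) * finc OX x |
                     b in [set b | b \in coinv pi] & x in [set: X]].

Definition L1_hcoact (xi : L1 OX) : L1 OX ⊗ H := tmap idfun pi (L1_coact xi).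

Definition wedge_hcoact (n : nat) : wedge OX n -> wedge OX n ⊗ H :=
  qlift (fun t => tmap (lclass _) idfun (tpow_coact L1_hcoact t)).

Definition wedge_form_hcoact (n : nat) :
    wedge OX n ⊗ X -> (wedge OX n ⊗ X) ⊗ H :=
  tcoact (@wedge_hcoact n) (hcoact pi).

(* The coinvariants of the subspace K^n ⊗ X of (L1 X)^n ⊗ X, where K^n is     *)
(* spanned by the n-fold wedge products of elements of K = ker pi.            *)
Definition kerX_coinv (n : nat) : set (wedge OX n ⊗ X) :=
  [set u | u \in lspan [set lclass _ t ⊗ x | t in tpow_pure ker_pi n &
                                             x in [set: X]]
           /\ wedge_form_hcoact u = u ⊗ 1].

End HopfFibration.

Arguments kerX_coinv {k X H OX OH} pi n _.

(* Main.v *)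
(* For omega in Omega^m B and xi in Omega^n X one has
     Delta_*(omega xi) = (omega ⊗ 1) Delta_*(xi)   modulo Omega X ⊗ J,
   where J is the right ideal generated by dB and by B^+ = B ∩ ker(counit):
   this holds for b and db because Delta B ⊂ X ⊗ B, and it is stable under
   products.  So Omega^m B ∧ Omega^n X determines omega xi_[-1] ⊗ xi_[0] modulo
   J, and multiplying by S(xi_[-1]) and averaging the first leg over H with the
   integral gives back omega ⊗ xi in Omega^m B ⊗_B Xi_0^n X: this inverts Theta.

   For the description of Omega^n B: a 1-form w lies in K.X as soon as
   id ⊗ pi_* kills its left coaction, whence dB ⊂ K.X and X.K ⊂ K.X, and
   condition K gives Omega^n B.X = K^n.X.  Averaging over H projects
   Omega^n B.X onto Omega^n B, so the coinvariants of K^n.X are Omega^n B. *)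
Require Import Defs.
From HB Require Import structures.
From mathcomp Require Import all_boot all_algebra.
From mathcomp Require Import boolp classical_sets cardinality fsbigop.
From mathcomp Require Import freeg.

Set Implicit Arguments.
Unset Strict Implicit.
Unset Printing Implicit Defensive.

Import GRing.Theory.
Local Open Scope ring_scope.
Local Open Scope classical_set_scope.

(** * Linearity of composite expressions *)

Section Linear.
Variables (k : fieldType) (U V W Z : lmodType k).

(** The inverse of Theta is built as one linear map on all of [OX ⊗ OX], composed with [fcomul], so
    that being well defined on Xi_m^n means only that it vanishes on Omega^{m+1}B ∧ Omega^{n-1}X.
    That is a matter of degree: a form on B of degree m+1 multiplies the first leg, of which only
    the component of degree m is kept. The obstacle is that killing Omega X ⊗ J has to hold for
    every first leg, whereas an element of B can cross the tensor sign only next to Omega^mB.X,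
    where the retraction [r] onto Omega^mB is right B-linear. A k-linear projection [e] onto
    Omega^mB.X, otherwise arbitrary, is therefore applied first. It does no harm: for omega in
    Omega^mB the component of degree m of omega u is omega times the degree 0 part of u, hence
    already in Omega^mB.X. Memberships in subspaces of tensor products are avoided: averaging the
    second leg stands for Delta B ⊂ X ⊗ B, linear maps that kill Omega X ⊗ J stand for the quotient
    by it, and splittings over k give exactness of tensor products. *)

Lemma lin_id : linear (fun x : U => x). Proof. by []. Qed.

Lemma lin_comp (h : V -> W) (f : U -> V) :
  linear h -> linear f -> linear (fun x => h (f x)).
Proof. by move=> hl fl a u v; rewrite fl hl. Qed.

Lemma lin_pack (h : {linear V -> W}) (f : U -> V) :
  linear f -> linear (fun x => h (f x)).
Proof. by move=> fl a u v; rewrite fl linearP. Qed.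

Lemma lin_scaler c (f : U -> V) : linear f -> linear (fun x => c *: f x).
Proof. by move=> fl a u v; rewrite fl scalerDr !scalerA mulrC. Qed.

Lemma lin_scalel (c : V) (f : U -> k^o) : linear f -> linear (fun x => f x *: c).
Proof. by move=> fl a u v; rewrite fl scalerDl -scalerA. Qed.

Lemma lin_add (f g : U -> V) :
  linear f -> linear g -> linear (fun x => f x + g x).
Proof. by move=> fl gl a u v; rewrite fl gl scalerDr addrACA. Qed.

Lemma lin_tmkl (c : W) (f : U -> V) : linear f -> linear (fun x => f x ⊗ c).
Proof. by move=> fl a u v; rewrite fl tmkDl tmkZl. Qed.

Lemma lin_tmkr (c : W) (f : U -> V) : linear f -> linear (fun x => c ⊗ f x).
Proof. by move=> fl a u v; rewrite fl tmkDr tmkZr. Qed.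

Lemma lin_tlift (f : V -> W -> Z) (g : U -> V ⊗ W) :
  bilinear_map f -> linear g -> linear (fun x => tlift f (g x)).
Proof. by move=> fb gl a u v; rewrite gl (tlift_linear fb). Qed.

Lemma lin_bil_l (f : V -> W -> Z) (g : U -> V) c :
  bilinear_map f -> linear g -> linear (fun x => f (g x) c).
Proof. by move=> [fl _] gl a u v; rewrite gl fl. Qed.

Lemma lin_bil_r (f : V -> W -> Z) (g : U -> W) c :
  bilinear_map f -> linear g -> linear (fun x => f c (g x)).
Proof. by move=> [_ fr] gl a u v; rewrite gl fr. Qed.

Lemma lin_zero (f : U -> V) : linear f -> f 0 = 0.
Proof.
by move=> fl; have := fl (-1) 0 0; rewrite scaleN1r oppr0 addr0 scaleN1r addNr.
Qed.

Lemma linD (f : U -> V) : linear f -> {morph f : x y / x + y}.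
Proof. by move=> fl x y; have := fl 1 x y; rewrite !scale1r. Qed.

Lemma linZ (f : U -> V) : linear f -> forall a x, f (a *: x) = a *: f x.
Proof. by move=> fl a x; have := fl a x 0; rewrite !addr0 (lin_zero fl) addr0. Qed.

Definition lmk (f : U -> V) (fl : linear f) : {linear U -> V} :=
  HB.pack f (GRing.isLinear.Build _ _ _ _ _ fl).

Lemma lmkE (f : U -> V) (fl : linear f) x : lmk fl x = f x. Proof. by []. Qed.

Lemma lin_comb_lin0 (S : set U) (f : U -> V) : linear f ->
  (forall u, S u -> f u = 0) -> forall u, lin_comb S u -> f u = 0.
Proof.
move=> fl f0 u; elim=> [|a v w /f0 v0 _ w0]; first exact: lin_zero.
by rewrite fl v0 w0 scaler0 addr0.
Qed.

Lemma lin_comb_eq (S : set U) (f g : U -> V) : linear f -> linear g ->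
  (forall u, S u -> f u = g u) -> forall u, lin_comb S u -> f u = g u.
Proof.
move=> fl gl fg u; elim=> [|a v w /fg vE _ wE]; first by rewrite !lin_zero.
by rewrite fl gl vE wE.
Qed.

Lemma lin_comb_map (S : set U) (T : set V) (f : U -> V) : linear f ->
  (forall u, S u -> lin_comb T (f u)) -> forall u, lin_comb S u -> lin_comb T (f u).
Proof.
move=> fl fST u; elim=> [|a v w /fST vT _ wT].
  by rewrite lin_zero //; exact: lin_comb0.
by rewrite fl; exact: lin_comb_lin.
Qed.

End Linear.

Section LinearAlg.
Variables (k : fieldType) (U : lmodType k) (A : algType k).

Lemma lin_mull (c : A) (f : U -> A) : linear f -> linear (fun x => f x * c).
Proof. by move=> fl a u v; rewrite fl mulrDl -scalerAl. Qed.

Lemma lin_mulr (c : A) (f : U -> A) : linear f -> linear (fun x => c * f x).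
Proof. by move=> fl a u v; rewrite fl mulrDr -scalerAr. Qed.

Lemma lin_tmull (C : algType k) (c : A ⊗ C) (f : U -> A ⊗ C) :
  linear f -> linear (fun x => tmul (f x) c).
Proof. by move=> fl a u v; rewrite fl tmul_linear_l. Qed.

Lemma lin_tmulr (C : algType k) (c : A ⊗ C) (f : U -> A ⊗ C) :
  linear f -> linear (fun x => tmul c (f x)).
Proof. by move=> fl a u v; rewrite fl tmul_linear_r. Qed.

End LinearAlg.

Section TensorExt.
Variables (k : fieldType) (U V W Z : lmodType k).

Lemma tensor_ext (f g : V ⊗ W -> Z) : linear f -> linear g ->
  (forall v w, f (v ⊗ w) = g (v ⊗ w)) -> forall t, f t = g t.
Proof.
move=> fl gl fg; elim/tensor_ind => [|v w t IH]; first by rewrite !lin_zero.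
by rewrite (linD fl) (linD gl) fg IH.
Qed.

Lemma eq_tlift (f g : V -> W -> Z) t :
  (forall v w, f v w = g v w) -> tlift f t = tlift g t.
Proof. by move=> fg; congr (tlift _ t); apply/funext => v; apply/funext => w. Qed.

(* [F x] need not be bilinear: [tlift] is computed on a chosen representative *)
(* in the free module.                                                        *)
Lemma lin_tlift_par (F : U -> V -> W -> Z) t :
  (forall v w, linear (fun x => F x v w)) -> linear (fun x => tlift (F x) t).
Proof.
move=> Fl a x y; rewrite /tlift /qlift.
have fgE (g : V -> W -> Z) (D : {freeg (V * W)%type / k}) :
    fglift (fun p => g p.1 p.2) D = \sum_(p <- dom D) coeff p D *: g p.1 p.2.
  rewrite -{1}[D]freeg_sumE.
  have := fglift_is_linear (fun p : V * W => g p.1 p.2).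
  set h := fglift _ => hl.
  rewrite [LHS](linear_sum (lmk hl)); apply: eq_bigr => p _.
  by rewrite /= /h liftU.
rewrite !fgE scaler_sumr -big_split; apply: eq_bigr => p _ /=.
by rewrite Fl scalerDr !scalerA mulrC.
Qed.

End TensorExt.

Section TmapMorph.
Variables (k : fieldType) (V V' W W' : lmodType k).
Variables (f : {linear V -> V'}) (g : {linear W -> W'}).

Lemma tmapP a s t : tmap f g (a *: s + t) = a *: tmap f g s + tmap f g t.
Proof. exact: linearP. Qed.

Lemma tmapD s t : tmap f g (s + t) = tmap f g s + tmap f g t.
Proof. exact: linearD. Qed.

Lemma tmap0 : tmap f g 0 = 0. Proof. exact: linear0. Qed.

End TmapMorph.

(** Recursion on the body: in a product or a tensor the variable may occur in one factor only, and
    both factors are tried. Plain functions are handled through [linear] and [bilinear_map] facts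
    put in the context beforehand. *)
Ltac linr :=
  lazymatch goal with
  | |- bilinear_map _ => first [assumption | split => ? /=; linr]
  | |- forall _, _ => move=> ? /=; linr
  | |- GRing.linear_for _ (fun x => x) => exact: lin_id
  | |- GRing.linear_for _ (tlift _) => apply: tlift_linear; linr
  | |- GRing.linear_for _ (tmk _) => exact: (tmk_bilinear _ _).2
  | |- GRing.linear_for _ (tmul _) => exact: tmul_linear_r
  | |- GRing.linear_for _ (GRing.mul _) => apply: lin_mulr; exact: lin_id
  | |- GRing.linear_for _ (GRing.scale _) => apply: lin_scaler; exact: lin_id
  | |- GRing.linear_for _ (fun x => tmk _ _) =>
      first [apply: lin_tmkl; linr | apply: lin_tmkr; linr]
  | |- GRing.linear_for _ (fun x => tlift _ _) =>
      first [apply: lin_tlift; linr | apply: lin_tlift_par; linr]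
  | |- GRing.linear_for _ (fun x => tmul _ _) =>
      first [apply: lin_tmull; linr | apply: lin_tmulr; linr]
  | |- GRing.linear_for _ (fun x => GRing.mul _ _) =>
      first [apply: lin_mull; linr | apply: lin_mulr; linr]
  | |- GRing.linear_for _ (fun x => GRing.scale _ _) =>
      first [apply: lin_scaler; linr | apply: lin_scalel; linr]
  | |- GRing.linear_for _ (fun x => GRing.add _ _) => apply: lin_add; linr
  | |- _ => first [ assumption
    | match goal with H : bilinear_map _ |- _ =>
        first [apply: (lin_bil_l _ H); linr | apply: (lin_bil_r _ H); linr] end
    | match goal with H : linear _ |- _ => apply: (lin_comp H); linr end
    | apply: lin_pack; linr | exact: linearP | by [] ]
  end.

(** * Complements and flatness over a field *)

Section Complement.
Variables (k : fieldType) (V : lmodType k).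

Lemma subspace_complement (W : {pred V}) : submod_closed W ->
  exists2 C : {pred V}, submod_closed C &
    (forall v, v \in C -> v \in W -> v = 0) /\
    (forall v, exists2 w, w \in W & v - w \in C).
Proof.
move=> Wc; have W0 := Wc.1; have Wl := Wc.2.
pose P (A : set V) := (forall a u v, A u -> A v -> A (a *: u + v)) /\
  (forall v, A v -> v \in W -> v = 0).
have [F FP Ftot|A [[Al AW] Amax]] := @Zorn_bigcup V P.
  split=> [a u v [A FA Au] [B FB Bv]|v [A FA Av]]; last exact: (FP _ FA).2.
  have [AB|BA] := Ftot _ _ FA FB.
    by exists B => //; apply: (FP _ FB).1 => //; exact: AB.
  by exists A => //; apply: (FP _ FA).1 => //; exact: BA.
pose A0 : {pred V} := fun v => `[< v = 0 \/ A v >].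
have A0l : submod_closed A0.
  split=> [|a u v /asboolP[->|Au] /asboolP[->|Av]]; apply/asboolP.
  - by left.
  - by left; rewrite scaler0 addr0.
  - by right; rewrite scaler0 add0r.
  - rewrite addr0; have [->|a0] := eqVneq a 0; first by left; rewrite scale0r.
    right; have -> : a *: u = (a - 1) *: u + u by rewrite scalerBl scale1r subrK.
    exact: Al.
  - by right; exact: Al.
exists A0 => //; split=> [v /asboolP[//|Av] Wv|v]; first exact: AW.
apply: contrapT => noW.
have vA : ~ A v.
  by move=> Av; apply: noW; exists 0 => //; rewrite subr0; apply/asboolP; right.
pose A' : set V := [set x | exists a u, u \in A0 /\ x = a *: v + u].
apply: (Amax A').
  split=> [|AA]; last first.
    by apply/vA/AA; exists 1, 0; split; [exact: A0l.1|rewrite scale1r addr0].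
  by move=> u Au; exists 0, u; split; [apply/asboolP; right|rewrite scale0r add0r].
split=> [a _ _ [b [u [uA ->]]] [c [w [wA ->]]]|_ [a [u [uA ->]]] Wx].
  exists (a * b + c), (a *: u + w); split; first exact: A0l.2.
  by rewrite scalerDr scalerA addrACA scalerDl.
(* If a is nonzero, dividing by it writes v as an element of W plus one of [A0], against [noW]. *)
have [a0|a0] := eqVneq a 0.
  move: Wx; rewrite a0 scale0r add0r => Wu.
  by move/asboolP: uA => [//|Au]; exact: AW.
case: noW; exists (v + a^-1 *: u).
  have := Wl a^-1 _ _ Wx W0.
  by rewrite addr0 scalerDr scalerA mulVf // scale1r.
have := A0l.2 (- a^-1) _ _ uA A0l.1.
by rewrite addr0 scaleNr opprD addrA subrr add0r.
Qed.

Lemma subspace_projection (W : {pred V}) : submod_closed W ->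
  exists p : {linear V -> V}, (forall v, p v \in W) /\ {in W, forall v, p v = v}.
Proof.
move=> Wc; have [C Cc [CW VWC]] := subspace_complement Wc.
have [p pP] := @choice _ _ (fun v w => w \in W /\ v - w \in C)
  (fun v => let: ex_intro2 w wW wC := VWC v in ex_intro _ w (conj wW wC)).
have p_uniq v w : w \in W -> v - w \in C -> p v = w.
  move=> wW wC; have [pW pC] := pP v; apply/eqP; rewrite -subr_eq0; apply/eqP.
  apply: CW.
    have := Cc.2 (-1) _ _ pC wC; rewrite scaleN1r opprB.
    by rewrite addrA subrK.
  by have := Wc.2 (-1) _ _ wW pW; rewrite scaleN1r addrC.
have pl : linear p.
  move=> a u v; have [puW puC] := pP u; have [pvW pvC] := pP v.
  apply: p_uniq; first exact: Wc.2.
  by rewrite opprD addrACA -scalerBr; exact: Cc.2.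
exists (lmk pl); split=> [v|v vW]; first by case: (pP v).
by apply: p_uniq; rewrite // subrr; exact: Cc.1.
Qed.

End Complement.

Section GenInverse.
Variables (k : fieldType) (U V : lmodType k).

(** Project onto the image of f, then take the preimage that lies in a complement of the kernel.
    This splitting is the source of every exactness statement about tensor products below. *)
Lemma generalised_inverse (f : {linear U -> V}) :
  exists g : {linear V -> U}, forall u, f (g (f u)) = f u.
Proof.
pose K : {pred U} := fun u => f u == 0.
have Kc : submod_closed K.
  split=> [|a u v /eqP u0 /eqP v0]; apply/eqP; first exact: linear0.
  by rewrite linearP u0 v0 scaler0 addr0.
pose I : {pred V} := fun v => `[< exists u, f u = v >].
have Ic : submod_closed I.
  split=> [|a _ _ /asboolP[u <-] /asboolP[v <-]]; apply/asboolP.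
    by exists 0; exact: linear0.
  by exists (a *: u + v); rewrite linearP.
have [p [pK pid]] := subspace_projection Kc.
have [q [qI qid]] := subspace_projection Ic.
have fK u v : f u = f v -> u - p u = v - p v.
  move=> uv; have : p (u - v) = u - v.
    by apply: pid; rewrite /K /= -topredE /= linearB uv subrr.
  rewrite linearB => /eqP; rewrite subr_eq => /eqP ->.
  by rewrite opprD opprB addrA addrCA subrr addr0.
have [h hP] := choice (fun v => asboolP _ (qI v)).
(* The chosen preimage [h v] need not be linear in v; removing its kernel component makes it
   independent of the choice. *)
have gl : linear (fun v => h v - p (h v)).
  move=> a u v; rewrite (fK _ (a *: h u + h v)).
    by rewrite linearP opprD addrACA -scalerBr.
  by rewrite linearP !hP linearP.
exists (lmk gl) => u /=.
have -> : f (h (f u) - p (h (f u))) = f (h (f u)).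
  by rewrite linearB (eqP (pK _)) subr0.
by rewrite hP qid //; apply/asboolP; exists u.
Qed.

End GenInverse.

Section Flatness.
Variables (k : fieldType) (U V W : lmodType k).

(** The identity is (1 - g f) + g f on the first leg; the second summand kills t, and 1 - g f takes
    values in the kernel of f. *)
Lemma tmap_ker (f : {linear U -> V}) (t : U ⊗ W) : tmap f idfun t = 0 ->
  lin_comb [set u ⊗ w | u in [set u | f u = 0] & w in [set: W]] t.
Proof.
have [g gP] := generalised_inverse f => t0.
have el : linear (fun u => u - g (f u)).
  by move=> a u v; rewrite (linearP f) (linearP g) opprD addrACA -scalerBr.
have tE (s : U ⊗ W) : s = tmap (lmk el) idfun s + tmap g idfun (tmap f idfun s).
  elim/tensor_ind: s => [|u w s {1}->]; first by rewrite !tmap0 addr0.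
  by rewrite !tmapD !tmapE /= addrACA -tmkDl subrK.
rewrite (tE t) t0 linear0 addr0; elim/tensor_ind: {t0}t => [|u w t IH].
  by rewrite tmap0; exact: lin_comb0.
rewrite tmapD tmapE -[_ ⊗ _]scale1r; apply: lin_comb_lin IH; apply: lin_comb_gen.
by exists (u - g (f u)) => /=; [rewrite linearB gP subrr|exists w].
Qed.

Lemma tmap_inj (f : {linear U -> V}) : injective f ->
  injective (tmap f (idfun : {linear W -> W})).
Proof.
have [g gP] := generalised_inverse f => f_inj.
have gK t : tmap g idfun (tmap f (idfun : {linear W -> W}) t) = t.
  elim/tensor_ind: t => [|u w t IH]; first by rewrite !tmap0.
  by rewrite !tmapD IH !tmapE (f_inj _ _ (gP u)).
exact: can_inj gK.
Qed.

End Flatness.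

(** * Sweedler calculus *)

Section TliftComp.
Variables (k : fieldType) (U V Z Z' : lmodType k).

Lemma tlift_comp (h : Z -> Z') (f : U -> V -> Z) t : linear h -> bilinear_map f ->
  h (tlift f t) = tlift (fun u v => h (f u v)) t.
Proof.
move=> hl fb; have hfb : bilinear_map (fun u v => h (f u v)).
  by case: fb => fl fr; split=> ? /=; apply: lin_comp.
move: t; apply: tensor_ext; [|exact: tlift_linear|].
  by apply: lin_comp => //; exact: tlift_linear.
by move=> u v; rewrite !tliftE.
Qed.

End TliftComp.

Section Fubini.
Variables (k : fieldType) (U V U' V' Z : lmodType k).

Lemma tlift_tmap (U1 V1 : lmodType k) (f : {linear U1 -> U}) (g : {linear V1 -> V})
    (F : U -> V -> Z) t : bilinear_map F ->
  tlift F (tmap f g t) = tlift (fun u v => F (f u) (g v)) t.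
Proof.
move=> Fb; rewrite /tmap (tlift_comp _ (tlift_linear Fb) (tmap_bilinear f g)).
by apply: eq_tlift => u v; rewrite tliftE.
Qed.

Lemma tlift_fubini (F : U -> V -> U' -> V' -> Z) s t :
  (forall u v, bilinear_map (F u v)) ->
  (forall u' v', bilinear_map (fun u v => F u v u' v')) ->
  tlift (fun u v => tlift (F u v) t) s =
  tlift (fun u' v' => tlift (fun u v => F u v u' v') s) t.
Proof.
move=> Fr Fl.
have Fb : bilinear_map (fun u v => tlift (F u v) t).
  by split=> ? /=; apply: lin_tlift_par => *; [apply: (Fl _ _).1|apply: (Fl _ _).2].
move: s; apply: tensor_ext => [||u v]; [exact: tlift_linear| |].
  by apply: lin_tlift_par => *; exact: tlift_linear.
rewrite tliftE //; apply: eq_tlift => u' v'.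
by rewrite tliftE.
Qed.

End Fubini.

Section Hopf.
Variables (k : fieldType) (X : hopfAlg k).

Local Notation D := (comul X).
Local Notation S := (antipode X).

Definition trilinear_map (U V W Z : lmodType k) (f : U -> V -> W -> Z) :=
  [/\ forall v w, linear (fun u => f u v w), forall u w, linear (fun v => f u v w)
    & forall u v, linear (f u v)].

(** The working form of coassociativity: both sides are the Sweedler sum f(x_(1), x_(2), x_(3)). *)
Lemma comul_coassoc (Z : lmodType k) (f : X -> X -> X -> Z) x : trilinear_map f ->
  tlift (fun a c => tlift (fun a' b => f a' b c) (D a)) (D x) =
  tlift (fun a b => tlift (f a) (D b)) (D x).
Proof.
case=> f1 f2 f3.
have fab a : bilinear_map (f a) by split=> ?; [exact: f2|exact: f3].
have fb : bilinear_map (fun a t => tlift (f a) t).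
  split=> ? /=; last exact: tlift_linear.
  by apply: lin_tlift_par => *; exact: f1.
have := congr1 (tlift (fun a t => tlift (f a) t)) (comulA x).
rewrite (tlift_tmap _ _ _ fb) /= => <-.
rewrite /tassoc (tlift_comp _ (tlift_linear fb)); last by linr.
rewrite tlift_tmap; last first.
  split=> ? /=; first by apply: lin_comp; [exact: tlift_linear|linr].
  by apply: lin_comp; [exact: tlift_linear|linr].
apply: eq_tlift => a c /=.
rewrite (tlift_comp _ (tlift_linear fb)); last by linr.
apply: eq_tlift => a' b /=.
by rewrite !tliftE.
Qed.

Lemma antipode1 : S 1 = 1.
Proof.
have := antipodel (1 : X); rewrite comul1 tliftE; last by linr.
by rewrite mulr1 rmorph1 scale1r.
Qed.

Lemma counit_coml (Z : lmodType k) (f : X -> Z) x : linear f ->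
  tlift (fun a b => counit X a *: f b) (D x) = f x.
Proof.
move=> fl; rewrite -{2}(counitl x) (tlift_comp (h := f)) //; last by linr.
by apply: eq_tlift => a b; rewrite (linZ fl).
Qed.

Lemma counit_comr (Z : lmodType k) (f : X -> Z) x : linear f ->
  tlift (fun a b => counit X b *: f a) (D x) = f x.
Proof.
move=> fl; rewrite -{2}(counitr x) (tlift_comp (h := f)) //; last by linr.
by apply: eq_tlift => a b; rewrite (linZ fl).
Qed.

Lemma tlift_tmul (A C : algType k) (Z : lmodType k) (F : A -> C -> Z) s t :
  bilinear_map F ->
  tlift F (tmul s t) = tlift (fun a c => tlift (fun a' c' => F (a * a') (c * c')) t) s.
Proof.
move=> Fb; rewrite {1}/tmul (tlift_comp _ (tlift_linear Fb) (tmul_bilinear_l t)).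
apply: eq_tlift => a c.
rewrite (tlift_comp _ (tlift_linear Fb) (tmul_pure_bilinear a c)).
by apply: eq_tlift => a' c'; rewrite tliftE.
Qed.

(* Multiplication has both (x, y) |-> S (x y) and (x, y) |-> S y S x as       *)
(* inverses for this convolution product, so that they agree.                 *)
Definition conv2 (f g : X -> X -> X) (x y : X) : X :=
  tlift (fun a b => tlift (fun c d => f a c * g b d) (D y)) (D x).

Local Notation eps2 := (fun x y : X => (counit X x * counit X y)%:A : X).

Lemma conv2A f g h x y : bilinear_map f -> bilinear_map g -> bilinear_map h ->
  conv2 (conv2 f g) h x y = conv2 f (conv2 g h) x y.
Proof.
move=> fb gb hb; rewrite /conv2.
have pull1 (p : X -> X -> X) t z : bilinear_map p ->
    tlift p t * z = tlift (fun a b => p a b * z) t.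
  by move=> pb; apply: (tlift_comp (h := fun u => u * z)) => //; linr.
have pull2 (p : X -> X -> X) t z : bilinear_map p ->
    z * tlift p t = tlift (fun a b => z * p a b) t.
  by move=> pb; apply: (tlift_comp (h := fun u => z * u)) => //; linr.
(* The sums over the legs of y are packed into [F], so that coassociativity is applied to x first
   and to y afterwards. *)
pose F a' b c :=
  tlift (fun u w => tlift (fun u' v => f a' u' * g b v * h c w) (D u)) (D y).
have Ft : trilinear_map F by split=> ? ?; rewrite /F; linr.
transitivity (tlift (fun a c => tlift (fun a' b => F a' b c) (D a)) (D x)).
  apply: eq_tlift => a c; rewrite /F.
  rewrite [RHS]tlift_fubini; [|by linr|by linr].
  apply: eq_tlift => u w.
  rewrite pull1; last by linr.
  by apply: eq_tlift => a' b; rewrite pull1 //; linr.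
rewrite comul_coassoc //.
transitivity (tlift (fun a c => tlift (fun b d => tlift (fun u w => tlift (fun v w' =>
    f a u * g b v * h d w') (D w)) (D y)) (D c)) (D x)).
  apply: eq_tlift => a c; apply: eq_tlift => b d; rewrite /F.
  by rewrite (comul_coassoc (f := fun u v w => f a u * g b v * h d w)) //; split; linr.
apply: eq_tlift => a c; rewrite tlift_fubini; [|by linr|by linr].
apply: eq_tlift => u w; rewrite pull2; last by linr.
apply: eq_tlift => b d; rewrite pull2; last by linr.
by apply: eq_tlift => v w'; rewrite mulrA.
Qed.

Lemma antipodeM x y : S (x * y) = S y * S x.
Proof.
pose m (x y : X) := x * y; pose mS x y := S (x * y); pose Sm x y := S y * S x.
have mb : bilinear_map m by rewrite /m; linr.
have mSb : bilinear_map mS by rewrite /mS; linr.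
have Smb : bilinear_map Sm by rewrite /Sm; linr.
have mS_m u v : conv2 mS m u v = eps2 u v.
  rewrite -rmorphM -antipodel comulM tlift_tmul //; linr.
have m_Sm u v : conv2 m Sm u v = eps2 u v.
  have -> : eps2 u v = counit X v *: tlift (fun a b => a * S b) (D u).
    by rewrite antipoder scalerA mulrC.
  rewrite (tlift_comp (h := fun w : X => counit X v *: w)); [|by linr|by linr].
  apply: eq_tlift => a b.
  rewrite (_ : _ *: _ = a * (counit X v)%:A * S b); last first.
    by rewrite -scalerAr mulr1 scalerAl.
  rewrite -antipoder (tlift_comp (h := fun w => a * w * S b)); [|by linr|by linr].
  by apply: eq_tlift => c d; rewrite /m /Sm !mulrA.
have mulA1 (a : k) (z : X) : a%:A * z = a *: z by rewrite -scalerAl mul1r.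
have mul1A (a : k) (z : X) : z * a%:A = a *: z by rewrite -scalerAr mulr1.
have e_l f u v : bilinear_map f -> conv2 eps2 f u v = f u v.
  move=> fb; rewrite -[RHS](counit_coml (f := f^~ v)); last by linr.
  apply: eq_tlift => a b; rewrite -[f b v](counit_coml (f := f b)); last by linr.
  rewrite (tlift_comp (h := fun w : X => counit X a *: w)); [|by linr|by linr].
  by apply: eq_tlift => c d; rewrite mulA1 scalerA.
have e_r f u v : bilinear_map f -> conv2 f eps2 u v = f u v.
  move=> fb; rewrite -[RHS](counit_comr (f := f^~ v)); last by linr.
  apply: eq_tlift => a b; rewrite -[f a v](counit_comr (f := f a)); last by linr.
  rewrite (tlift_comp (h := fun w : X => counit X b *: w)); [|by linr|by linr].
  by apply: eq_tlift => c d; rewrite mul1A scalerA.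
have -> : S (x * y) = conv2 mS (conv2 m Sm) x y.
  rewrite -[LHS](e_r mS) //; congr (conv2 _ _ x y).
  by apply/funext => u; apply/funext => v; rewrite m_Sm.
rewrite -conv2A // -[RHS](e_l Sm) //; congr (conv2 _ _ x y).
by apply/funext => u; apply/funext => v; rewrite mS_m.
Qed.

End Hopf.

(** * Forms, their graded tensor square and the coactions *)

Section Calculus.
Variables (k : fieldType) (A : algType k) (OA : calculus A).

Local Notation fc := (fcomp OA).

Lemma form_homog (P : OA -> Prop) :
  P 0 -> (forall u v, P u -> P v -> P (u + v)) ->
  (forall n w, fc n w = w -> P w) -> forall w, P w.
Proof.
move=> P0 PD Ph w; have [N _ ->] := fcomp_bound w.
by elim/big_ind: _ => // i _; apply: (Ph i); rewrite fcompK eqxx.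
Qed.

Lemma form_ext (Z : lmodType k) (f g : OA -> Z) : linear f -> linear g ->
  (forall n w, fc n w = w -> f w = g w) -> forall w, f w = g w.
Proof.
move=> fl gl fg; apply: form_homog => // [|u v uE vE]; first by rewrite !lin_zero.
by rewrite (linD fl) (linD gl) uE vE.
Qed.

Lemma fcompM m n p w z : fc m w = w -> fc n z = z ->
  fc p (w * z) = if p == (m + n)%N then w * z else 0.
Proof.
move=> mw nz; rewrite -(fmul_deg mw nz) fcompK.
by case: eqP => // ->; rewrite !(fmul_deg mw nz).
Qed.

Lemma fbase_linear : linear (@fbase k A OA).
Proof.
move=> a u v; apply: (@finc_inj _ _ OA).
by rewrite linearP /= !fbaseE linearP.
Qed.

HB.instance Definition _ := GRing.isLinear.Build k OA A *:%R (@fbase k A OA) fbase_linear.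

Local Notation fb := (@fbase k A OA).

Lemma fbase_finc a : fb (finc OA a) = a.
Proof. by apply: (@finc_inj _ _ OA); rewrite fbaseE finc_deg0. Qed.

Lemma fbase_deg n w : fc n.+1 w = w -> fb w = 0.
Proof.
move=> nw; apply: (@finc_inj _ _ OA).
by rewrite fbaseE (fcomp_neq nw) // linear0.
Qed.

Lemma fbaseM w z : fb (w * z) = fb w * fb z.
Proof.
move: w; apply: form_ext; [by linr|by linr|] => m w mw.
move: z; apply: form_ext; [by linr|by linr|] => n z nz.
apply: (@finc_inj _ _ OA); rewrite rmorphM /= !fbaseE (fcompM _ mw nz).
case: m mw => [|m] mw; last by rewrite (fcomp_neq mw) // mul0r.
case: n nz => [|n] nz; last by rewrite (fcomp_neq nz) // mulr0.
by rewrite mw nz.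
Qed.

Lemma fbase_d w : fb (fd OA w) = 0.
Proof.
move: w; apply: form_ext; [by linr| |] => [a u v|n w /fd_deg /fbase_deg //].
by rewrite scaler0 addr0.
Qed.

Lemma fcomp0E w : fc 0 w = finc OA (fb w). Proof. by rewrite fbaseE. Qed.

Local Notation kz := (@koszul k (dga_of OA)).

Lemma koszulE p w N : (forall n, (N <= n)%N -> fc n w = 0) ->
  kz p w = \sum_(q < N) (-1) ^+ (p * q) *: fc q w.
Proof. by move=> wN; apply: fsbig_nat_bound => n /wN wn; rewrite /= wn scaler0. Qed.

Lemma fcomp_bound2 u v : exists N, forall n, (N <= n)%N -> fc n u = 0 /\ fc n v = 0.
Proof.
have [M uM _] := fcomp_bound u; have [N vN _] := fcomp_bound v.
exists (maxn M N) => n; rewrite geq_max => /andP[nM nN].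
by rewrite uM // vN.
Qed.

Lemma koszul_linear p : linear (kz p).
Proof.
move=> a u v; have [N uv] := fcomp_bound2 u v.
rewrite (@koszulE _ u N) => [|n /uv[]//]; rewrite (@koszulE _ v N) => [|n /uv[]//].
rewrite (@koszulE _ _ N) => [|n /uv[u0 v0]]; last by rewrite linearP u0 v0 scaler0 addr0.
rewrite scaler_sumr -big_split; apply: eq_bigr => q _ /=.
by rewrite linearP scalerDr !scalerA mulrC.
Qed.

Lemma koszul_deg p n w : fc n w = w -> kz p w = (-1) ^+ (p * n) *: w.
Proof.
move=> nw; rewrite (@koszulE p w n.+1) => [|m mn]; last first.
  by rewrite (fcomp_neq nw) // gtn_eqF.
rewrite big_ord_recr /= nw big1 ?add0r // => i _.
by rewrite (fcomp_neq nw) ?scaler0 // ltn_eqF.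
Qed.

Lemma koszul0 w : kz 0 w = w.
Proof.
move: w; apply: form_ext; [exact: koszul_linear|by linr|] => n w nw.
by rewrite (koszul_deg _ nw) mul0n expr0 scale1r.
Qed.

Lemma fbase_koszul p w : fb (kz p w) = fb w.
Proof.
move: w; apply: form_ext; [|by linr|] => [|n w nw].
  by apply: lin_pack; exact: koszul_linear.
rewrite (koszul_deg _ nw) linearZ /=.
case: n nw => [|n] nw; first by rewrite muln0 expr0 scale1r.
by rewrite (fbase_deg nw) scaler0.
Qed.

Definition gmul (w z w' z' : OA) : OA ⊗ OA :=
  \sum_(p \in [set: nat]) (w * kz p w') ⊗ (fc p z * z').

Lemma gmulE w z w' z' N : (forall n, (N <= n)%N -> fc n z = 0) ->
  gmul w z w' z' = \sum_(p < N) (w * kz p w') ⊗ (fc p z * z').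
Proof. by move=> zN; apply: fsbig_nat_bound => n /zN ->; rewrite mul0r tmk0r. Qed.

Lemma gmul_bilinear_r w z : bilinear_map (gmul w z).
Proof.
have [N zN _] := fcomp_bound z.
split=> [z' a u v|w' a u v] /=; rewrite !(gmulE _ _ _ zN) scaler_sumr -big_split;
  apply: eq_bigr => p _ /=.
  by rewrite koszul_linear mulrDr -scalerAr tmkDl tmkZl.
by rewrite mulrDr -scalerAr tmkDr tmkZr.
Qed.

Lemma gmul_bilinear_l w' z' : bilinear_map (fun w z => gmul w z w' z').
Proof.
split=> [z a u v|w a u v] /=.
  have [N zN _] := fcomp_bound z.
  rewrite !(gmulE _ _ _ zN) scaler_sumr -big_split; apply: eq_bigr => p _ /=.
  by rewrite mulrDl -scalerAl tmkDl tmkZl.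
have [N uv] := fcomp_bound2 u v.
rewrite (@gmulE _ u _ _ N) => [|n /uv[]//]; rewrite (@gmulE _ v _ _ N) => [|n /uv[]//].
rewrite (@gmulE _ _ _ _ N) => [|n /uv[u0 v0]]; last first.
  by rewrite linearP u0 v0 scaler0 addr0.
rewrite scaler_sumr -big_split; apply: eq_bigr => q _ /=.
by rewrite linearP mulrDl -scalerAl tmkDr tmkZr.
Qed.

Lemma gmul_deg w q z w' z' : fc q z = z -> gmul w z w' z' = (w * kz q w') ⊗ (z * z').
Proof.
move=> qz; rewrite (@gmulE _ _ _ _ q.+1) => [|m mq]; last first.
  by rewrite (fcomp_neq qz) // gtn_eqF.
rewrite big_ord_recr /= qz big1 ?add0r // => i _.
by rewrite (fcomp_neq qz) ?mul0r ?tmk0r // ltn_eqF.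
Qed.

Local Notation pm := (@pmul k (tensor_dga (dga_of OA) (dga_of OA))).

Lemma pmul_bilinear : bilinear_map (pm : OA ⊗ OA -> OA ⊗ OA -> OA ⊗ OA).
Proof.
have lb t : bilinear_map (fun w z => tlift (gmul w z) t).
  split=> ? /=; apply: lin_tlift_par => *.
    exact: (gmul_bilinear_l _ _).1.
  exact: (gmul_bilinear_l _ _).2.
split=> [t|s] /=; first exact: (tlift_linear (lb t)).
apply: lin_tlift_par => w z; exact: (tlift_linear (gmul_bilinear_r w z)).
Qed.

Lemma pmul_tmk w z w' z' : pm (w ⊗ z) (w' ⊗ z') = gmul w z w' z'.
Proof.
have lb t : bilinear_map (fun w z => tlift (gmul w z) t).
  split=> ? /=; apply: lin_tlift_par => *.
    exact: (gmul_bilinear_l _ _).1.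
  exact: (gmul_bilinear_l _ _).2.
by rewrite /= (tliftE (lb _)) (tliftE (gmul_bilinear_r _ _)).
Qed.

End Calculus.

Section FormInd.
Variables (k : fieldType) (A : algType k) (OA : calculus A).

(** By [fgen], forms of degree n+1 are combinations of a dz with z of degree n. An identity known on
    A thus spreads to all forms once it is stable under d and under left multiplication by A. *)
Lemma form_gen_ind (P : OA -> Prop) :
  (forall a u v, P u -> P v -> P (a *: u + v)) -> (forall a, P (finc OA a)) ->
  (forall w, P w -> P (fd OA w)) -> (forall a w, P w -> P (finc OA a * w)) ->
  forall w, P w.
Proof.
move=> Pl Pi Pd Pm; have P0 : P 0 by rewrite -(linear0 (finc OA)); exact: Pi.
apply: form_homog => // [u v Pu Pv|n]; first by rewrite -[u]scale1r; exact: Pl.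
elim: n => [w /finc_deg[a ->] //|n IH w /fgen].
by apply: lin_comb_le => // _ [a _ [z /IH Pz <-]]; apply/Pm/Pd.
Qed.

End FormInd.

Section Coactions.
Variables (k : fieldType) (X : hopfAlg k) (OX : comul_diff X).

Local Notation fb := (@fbase k X OX).
Local Notation fi := (finc OX).
Local Notation D := (comul X).

Definition fcomul : {linear OX -> (OX ⊗ OX)%type} := dga_fun (cd_comul OX).

Local Notation pm := (@pmul k (tensor_dga (dga_of OX) (dga_of OX))).

Lemma fcomulM w z : fcomul (w * z) = pm (fcomul w) (fcomul z).
Proof. exact: (dga_mapM (cd_comul OX)). Qed.

Lemma fcomul_inc x : fcomul (fi x) = tmap fi fi (D x).
Proof. exact: cd_ext. Qed.

Lemma tensor_d_bilinear : bilinear_map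
  (fun w z : OX => fd OX w ⊗ z + koszul (D := dga_of OX) 1 w ⊗ fd OX z).
Proof. by have kl := @koszul_linear _ _ OX 1; linr. Qed.

Lemma fcomul_d w : fcomul (fd OX w) =
  tlift (fun w z : OX => fd OX w ⊗ z + koszul (D := dga_of OX) 1 w ⊗ fd OX z)
    (fcomul w).
Proof. exact: (dga_map_d (cd_comul OX)). Qed.

Lemma lcoact_linear : linear (@lcoact k X OX).
Proof. by move=> a u v; rewrite /lcoact !linearP. Qed.
HB.instance Definition _ := GRing.isLinear.Build k OX (X ⊗ OX)%type *:%R
  (@lcoact k X OX) lcoact_linear.

Lemma rcoact_linear : linear (@rcoact k X OX).
Proof. by move=> a u v; rewrite /rcoact !linearP. Qed.
HB.instance Definition _ := GRing.isLinear.Build k OX (OX ⊗ X)%type *:%R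
  (@rcoact k X OX) rcoact_linear.

Local Notation lc := (@lcoact k X OX).
Local Notation rc := (@rcoact k X OX).

Lemma lcoactE w : lc w = tmap fb idfun (fcomul w). Proof. by []. Qed.
Lemma rcoactE w : rc w = tmap idfun fb (fcomul w). Proof. by []. Qed.

(** The Koszul sign arises when the second leg of w passes the first leg of z. Here [fbase] keeps
    only degree 0 of the latter, and in [rcoactM] of the former, so the ungraded product [tmul]
    suffices. *)
Lemma lcoactM w z : lc (w * z) = tmul (lc w) (lc z).
Proof.
rewrite !lcoactE fcomulM; move: (fcomul w) (fcomul z) => s t.
have pb := pmul_bilinear OX.
move: s; apply: tensor_ext; [by linr|by linr|] => {}w z'.
move: t; apply: tensor_ext; [by linr|by linr|] => w1 z1.
rewrite pmul_tmk !tmapE tmulE /=.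
move: z'; apply: form_ext => [||q {}z qz]; last 1 first.
- by rewrite (gmul_deg _ _ _ qz) tmapE /= fbaseM fbase_koszul.
- by have gl : linear (fun z => gmul w z w1 z1) := (gmul_bilinear_l w1 z1).2 w; linr.
- by linr.
Qed.

Lemma rcoactM w z : rc (w * z) = tmul (rc w) (rc z).
Proof.
rewrite !rcoactE fcomulM; move: (fcomul w) (fcomul z) => s t.
have pb := pmul_bilinear OX.
move: s; apply: tensor_ext; [by linr|by linr|] => {}w z'.
move: t; apply: tensor_ext; [by linr|by linr|] => w1 z1.
rewrite pmul_tmk !tmapE tmulE /=.
move: z'; apply: form_ext => [||q {}z qz]; last 1 first.
- rewrite (gmul_deg _ _ _ qz) tmapE /= fbaseM.
  case: q qz => [|q] qz; first by rewrite koszul0.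
  by rewrite (fbase_deg qz) mul0r !tmk0r.
- by have gl : linear (fun z => gmul w z w1 z1) := (gmul_bilinear_l w1 z1).2 w; linr.
- by linr.
Qed.

Lemma lcoact_inc x : lc (fi x) = tmap idfun fi (D x).
Proof.
rewrite lcoactE fcomul_inc; move: (D x); apply: tensor_ext; [by linr|by linr|] => a b.
by rewrite !tmapE /= fbase_finc.
Qed.

Lemma rcoact_inc x : rc (fi x) = tmap fi idfun (D x).
Proof.
rewrite rcoactE fcomul_inc; move: (D x); apply: tensor_ext; [by linr|by linr|] => a b.
by rewrite !tmapE /= fbase_finc.
Qed.

(** Of the two Leibniz terms on the tensor square, the one that differentiates the degree 0 leg is
    killed by [fbase]. *)
Lemma lcoact_d w : lc (fd OX w) = tmap idfun (fd OX) (lc w).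
Proof.
have db := tensor_d_bilinear.
rewrite !lcoactE fcomul_d; move: (fcomul w); apply: tensor_ext; [by linr|by linr|] => a b.
by rewrite (tliftE db) tmapD !tmapE /= fbase_d tmk0l add0r fbase_koszul.
Qed.

Lemma rcoact_d w : rc (fd OX w) = tmap (fd OX) idfun (rc w).
Proof.
have db := tensor_d_bilinear.
rewrite !rcoactE fcomul_d; move: (fcomul w); apply: tensor_ext; [by linr|by linr|] => a b.
by rewrite (tliftE db) tmapD !tmapE /= fbase_d tmk0r addr0.
Qed.

End Coactions.

Section Quotient.
Variables (k : fieldType) (V Z : lmodType k) (S : set V) (f : V -> Z).
Hypotheses (fl : linear f) (f0 : forall v, S v -> f v = 0).

Lemma qlift_class v : qlift f (lclass S v) = f v.
Proof. exact: (qliftE (f := lmk fl) f0). Qed.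

Lemma qlift_linear : linear (qlift f : lquot S -> Z).
Proof.
move=> a p q; rewrite -[p]lclass_reprK -[q]lclass_reprK -linearP.
by rewrite !qlift_class fl.
Qed.

End Quotient.

Lemma tlift_tmk (k : fieldType) (U V Z : lmodType k) (f : U ⊗ V -> Z) t :
  linear f -> f t = tlift (fun u v => f (u ⊗ v)) t.
Proof.
move=> fl; have fb : bilinear_map (fun u v => f (u ⊗ v)) by linr.
by move: t; apply: tensor_ext => // [|u v]; [exact: tlift_linear|rewrite tliftE].
Qed.

Lemma tassocE (k : fieldType) (U V W : lmodType k) (u : U) (v : V) (w : W) :
  tassoc (u ⊗ v ⊗ w) = u ⊗ (v ⊗ w).
Proof. by rewrite /tassoc !tliftE; linr. Qed.

(** * Left-invariant forms *)

Section LeftInvariant.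
Variables (k : fieldType) (X : hopfAlg k) (OX : comul_diff X).

Local Notation lc := (@lcoact k X OX).
Local Notation rc := (@rcoact k X OX).
Local Notation fi := (finc OX).
Local Notation D := (comul X).

Lemma L1P (xi : L1 OX) : formn OX 1 (val xi) /\ lc (val xi) = 1 ⊗ val xi.
Proof.
have /lspanP := valP xi; move: (val xi) => w; elim=> [|a u v [u1 ul] _ [v1 vl]].
  by rewrite /formn /= !linear0 tmk0r.
by rewrite /formn /= !linearP /= u1 ul v1 vl tmkDr tmkZr.
Qed.

Lemma L1_intro w : formn OX 1 w -> lc w = 1 ⊗ w -> exists xi : L1 OX, val xi = w.
Proof.
move=> w1 wl; have wS : w \in lspan [set w : OX | formn OX 1 w /\ lc w = 1 ⊗ w].
  exact: sub_lspan.
by exists (LSub wS).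
Qed.

(** [comul_diff] records no coassociativity of [fcomul]; the identity is coassociativity of [comul]
    on X and is carried to forms by [form_gen_ind]. *)
Lemma lrcoact_compat w : tassoc (tmap lc idfun (rc w)) = tmap idfun rc (lc w).
Proof.
have al : linear (@tassoc k X OX X) by rewrite /tassoc; linr.
move: w; apply: form_gen_ind.
- by move=> a u v uE vE; rewrite !linearP /= al uE vE.
- move=> x; rewrite rcoact_inc lcoact_inc.
  pose f a b c := a ⊗ (fi b ⊗ c) : X ⊗ (OX ⊗ X).
  have ft : trilinear_map f by split=> ? ?; rewrite /f; linr.
  transitivity (tlift (fun a c => tlift (fun a' b => f a' b c) (D a)) (D x)).
    rewrite [LHS](tlift_tmk (f := fun t =>
      tassoc (tmap lc idfun (tmap fi idfun t)))); last by linr.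
    apply: eq_tlift => a c; rewrite !tmapE /= lcoact_inc.
    rewrite [LHS](tlift_tmk (f := fun t : X ⊗ X =>
      tassoc ((tmap (idfun : {linear X -> X}) fi t) ⊗ c))); last by linr.
    by apply: eq_tlift => a' b; rewrite tmapE tassocE.
  rewrite comul_coassoc //.
  rewrite [RHS](tlift_tmk (f := fun t => tmap idfun rc (tmap idfun fi t))); last by linr.
  apply: eq_tlift => a c; rewrite !tmapE /= rcoact_inc.
  rewrite [RHS](tlift_tmk (f := fun t => a ⊗ (tmap fi idfun t : OX ⊗ X)));
    last by linr.
  by apply: eq_tlift => a' b; rewrite tmapE.
- move=> w IH; rewrite rcoact_d lcoact_d.
  transitivity (tmap idfun (tmap (fd OX) idfun) (tassoc (tmap lc idfun (rc w)))).
    move: (rc w); apply: tensor_ext; [by linr|by linr|] => v x.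
    rewrite !tmapE /= lcoact_d.
    move: (lc v); apply: tensor_ext => [||y u]; [linr|linr|].
    by rewrite !(tmapE, tassocE) /= !tmapE.
  rewrite IH; move: (lc w); apply: tensor_ext; [by linr|by linr|] => y v.
  by rewrite !tmapE /= rcoact_d.
move=> x w IH.
(* [P a b c] is left multiplication by a ⊗ b ⊗ c on X ⊗ OX ⊗ X, to be summed over the threefold
   coproduct of x. *)
pose T a b c (y : X) (v : OX) (z : X) := (a * y) ⊗ ((fi b * v) ⊗ (c * z)).
pose P a b c u := tlift (fun y q => tlift (fun v z => T a b c y v z) q) u.
have Pt u : trilinear_map (fun a b c => P a b c u) by split=> ? ?; rewrite /P /T; linr.
have PE a b c y v z : P a b c (y ⊗ (v ⊗ z)) = T a b c y v z.
  by rewrite /P tliftE ?tliftE //; rewrite /T; linr.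
transitivity (tlift (fun a c =>
    tlift (fun a' b => P a' b c (tassoc (tmap lc idfun (rc w)))) (D a)) (D x)).
  rewrite rcoactM rcoact_inc.
  rewrite [LHS](tlift_tmk (f := fun t =>
    tassoc (tmap lc idfun (tmul (tmap fi idfun t) (rc w))))); last by linr.
  apply: eq_tlift => a c; rewrite tmapE /=.
  move: (rc w); apply: tensor_ext => [||v z]; [linr|rewrite /P /T; linr|].
  rewrite tmulE !tmapE /= lcoactM lcoact_inc.
  move: (lc v); apply: tensor_ext => [||y u]; [linr|rewrite /P /T; linr|].
  rewrite [LHS](tlift_tmk (f := fun t =>
    tassoc (tmul (tmap idfun fi t) (y ⊗ u) ⊗ (c * z)))); last by linr.
  by apply: eq_tlift => a' b; rewrite tmapE tmulE !tassocE PE.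
rewrite IH comul_coassoc // lcoactM lcoact_inc.
rewrite [RHS](tlift_tmk (f := fun t =>
  tmap idfun rc (tmul (tmap idfun fi t) (lc w)))); last by linr.
apply: eq_tlift => a c; rewrite tmapE /=.
move: (lc w); apply: tensor_ext => [||y v]; [rewrite /P /T; linr|linr|].
rewrite tmulE !tmapE /= rcoactM rcoact_inc.
move: (rc v); apply: tensor_ext => [||u z]; [rewrite /P /T; linr|linr|].
rewrite [RHS](tlift_tmk (f := fun t =>
  (a * y) ⊗ tmul (tmap fi idfun t) (u ⊗ z))); last by linr.
by apply: eq_tlift => b c'; rewrite tmapE tmulE PE.
Qed.

Lemma fcomul_comp n w : fcomul OX (fcomp OX n w) =
  \sum_(i < n.+1) tmap (fcomp OX i) (fcomp OX (n - i)%N) (fcomul OX w).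
Proof. exact: (dga_map_comp (cd_comul OX)). Qed.

Lemma lcoact_comp n w : lc (fcomp OX n w) = tmap idfun (fcomp OX n) (lc w).
Proof.
rewrite !lcoactE fcomul_comp linear_sum /= big_ord_recl big1 ?addr0 => [|i _].
  rewrite subn0; move: (fcomul OX w); apply: tensor_ext => [||u v]; [linr|linr|].
  by rewrite !tmapE /= fcomp0E fbase_finc.
move: (fcomul OX w); apply: (tensor_ext (g := fun _ => 0)) => [||u v]; [linr| |].
  by move=> a x y; rewrite scaler0 addr0.
by rewrite !tmapE /= (@fbase_deg _ _ _ i) ?tmk0l // fcompK eqxx.
Qed.

Lemma rcoact_comp n w : rc (fcomp OX n w) = tmap (fcomp OX n) idfun (rc w).
Proof.
rewrite !rcoactE fcomul_comp linear_sum /= big_ord_recr /= big1 ?add0r => [|i _].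
  rewrite subnn; move: (fcomul OX w); apply: tensor_ext => [||u v]; [linr|linr|].
  by rewrite !tmapE /= fcomp0E fbase_finc.
move: (fcomul OX w); apply: (tensor_ext (g := fun _ => 0)) => [||u v]; [linr| |].
  by move=> a x y; rewrite scaler0 addr0.
rewrite !tmapE /= -[(n - i)%N]prednK ?subn_gt0 // (@fbase_deg _ _ _ (n - i).-1) ?tmk0r //.
by rewrite fcompK eqxx.
Qed.

Lemma L1_val_linear : linear (val : L1 OX -> OX).
Proof. by []. Qed.

Lemma wedge_prod_linear n : linear (@wedge_prod k X OX n).
Proof.
elim: n => [|n IH]; first by move=> a u v; rewrite /= scalerDl scalerA.
have bil : bilinear_map (fun (xi : L1 OX) (t : tpow (L1 OX) n) => val xi * wedge_prod t).
  have vl := L1_val_linear; split=> ?; [exact: lin_mull|exact: lin_mulr].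
exact: (tlift_linear bil).
Qed.

Lemma wedge_prodS n xi t :
  @wedge_prod k X OX n.+1 (xi ⊗ t) = val xi * wedge_prod t.
Proof.
have bil : bilinear_map (fun (xi : L1 OX) (t : tpow (L1 OX) n) => val xi * wedge_prod t).
  have vl := L1_val_linear; split=> ?; [exact: lin_mull|].
  by apply: lin_mulr; exact: wedge_prod_linear.
exact: (tliftE bil).
Qed.

Definition linv n (w : OX) := formn OX n w /\ lc w = 1 ⊗ w.

Lemma linv_lin n a u v : linv n u -> linv n v -> linv n (a *: u + v).
Proof.
by move=> [un ul] [vn vl]; rewrite /linv /formn /= !linearP /= un ul vn vl tmkDr tmkZr.
Qed.

Lemma linv1 : linv 0 1.
Proof.
rewrite /linv /formn /= -(rmorph1 fi) finc_deg0; split=> //.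
by rewrite lcoact_inc comul1 tmapE.
Qed.

Lemma linv0 n : linv n 0.
Proof. by rewrite /linv /formn /= !linear0 tmk0r. Qed.

Lemma linvM m n u v : linv m u -> linv n v -> linv (m + n) (u * v).
Proof.
move=> [um ul] [vn vl]; split; first exact: fmul_deg um vn.
by rewrite lcoactM ul vl tmulE mulr1.
Qed.

Lemma wedge_prod_inv n (t : tpow (L1 OX) n) : linv n (wedge_prod t).
Proof.
elim: n t => [|n IH] t.
  have := linv_lin t linv1 (linv0 0); rewrite addr0; exact.
move: t; apply: tensor_ind => [|xi t s ts].
  by rewrite (lin_zero (@wedge_prod_linear n.+1)); exact: linv0.
rewrite (linD (@wedge_prod_linear n.+1)) wedge_prodS -[_ * _]scale1r.
apply: linv_lin ts; exact: linvM (L1P xi) (IH t).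
Qed.

End LeftInvariant.

(** * Forms as wedge powers times X *)

Section Wedge.
Variables (k : fieldType) (X : hopfAlg k) (OX : bicovariant X).

Local Notation fi := (finc OX).

Lemma wedge_prod_rel n t : @braid_rel k X OX n t -> wedge_prod t = 0.
Proof. by have [+ _ _] := bic_woronowicz OX n; exact. Qed.

Lemma wedge_form_bilinear n : bilinear_map
  (fun (q : wedge OX n) (x : X) => qlift (@wedge_prod k X OX n) q * fi x).
Proof.
have ql := qlift_linear (@wedge_prod_linear k X OX n) (@wedge_prod_rel n).
split=> ?; first exact: lin_mull.
by apply: lin_mulr; apply: lin_pack; exact: lin_id.
Qed.

Lemma wedge_form_linear n : linear (@wedge_form k X OX n).
Proof. exact: (tlift_linear (wedge_form_bilinear n)). Qed.

Lemma wedge_formE n q x :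
  @wedge_form k X OX n (q ⊗ x) = qlift (@wedge_prod k X OX n) q * fi x.
Proof. exact: (tliftE (wedge_form_bilinear n)). Qed.

Lemma wedge_form_class n t x :
  @wedge_form k X OX n (lclass _ t ⊗ x) = wedge_prod t * fi x.
Proof.
by rewrite wedge_formE (qlift_class (@wedge_prod_linear k X OX n) (@wedge_prod_rel n)).
Qed.

(** Surjectivity of [wedge_form], combined with the invariance of wedge products: linear identities
    on n-forms need checking only on eta x with eta left-invariant. *)
Lemma form_span n w : formn OX n w ->
  lin_comb [set v * fi x | v in linv (OX := OX) n & x in [set: X]] w.
Proof.
have [_ _ <-] := bic_woronowicz OX n; case=> u _ <-.
move: u; apply: tensor_ind => [|q x u IH].
  by rewrite (lin_zero (@wedge_form_linear n)); exact: lin_comb0.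
rewrite (linD (@wedge_form_linear n)) -[wedge_form (q ⊗ x)]scale1r.
apply: lin_comb_lin IH; apply: lin_comb_gen.
rewrite -[q]lclass_reprK wedge_form_class.
by exists (wedge_prod (repr q)); [exact: wedge_prod_inv|exists x].
Qed.

End Wedge.

(** * Differentiable maps and their effect on coactions *)

Section DiffMap.
Variables (k : fieldType) (A C : algType k) (OA : calculus A) (OC : calculus C).
Variable f : diff_map OA OC.

Definition dform : {linear OA -> OC} := dga_fun (dm_form f).

Lemma dformM w z : dform (w * z) = dform w * dform z.
Proof. exact: (dga_mapM (dm_form f)). Qed.

Lemma dform_d w : dform (fd OA w) = fd OC (dform w).
Proof. exact: (dga_map_d (dm_form f)). Qed.

Lemma dform_comp n w : dform (fcomp OA n w) = fcomp OC n (dform w).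
Proof. exact: (dga_map_comp (dm_form f)). Qed.

Lemma dform_inc a : dform (finc OA a) = finc OC (f a).
Proof. exact: dm_ext. Qed.

End DiffMap.

Section Naturality.
Variables (k : fieldType) (X H : hopfAlg k) (OX : comul_diff X) (OH : comul_diff H).
Variable f : diff_map OX OH.
Hypothesis f_hopf : hopf_map f.

Lemma lcoact_dform w : lcoact (dform f w) = tmap f (dform f) (lcoact w).
Proof.
move: w; apply: form_gen_ind.
- by move=> a u v uE vE; rewrite !linearP /= uE vE.
- move=> x; rewrite dform_inc !lcoact_inc f_hopf.1.
  move: (comul X x); apply: tensor_ext => [||a b]; [linr|linr|].
  by rewrite !tmapE /= dform_inc.
- move=> w IH; rewrite dform_d !lcoact_d IH.
  move: (lcoact w); apply: tensor_ext => [||a v]; [linr|linr|].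
  by rewrite !tmapE /= dform_d.
move=> x w IH; rewrite dformM !lcoactM IH dform_inc !lcoact_inc f_hopf.1.
move: (comul X x); apply: tensor_ext => [||a b]; [linr|linr|].
move: (lcoact w); apply: tensor_ext => [||y v]; [linr|linr|].
by rewrite !tmapE !tmulE tmapE /= rmorphM dformM dform_inc.
Qed.

End Naturality.

Section AntipodeInv.
Variables (k : fieldType) (X : hopfAlg k).

Local Notation Si := (antipode_inv (h := X)).

Lemma antipode_inv_linear : linear Si.
Proof.
move=> a x y; apply: (can_inj (@antipodeK k X)).
by rewrite linearP /= !antipode_invK.
Qed.

(** Applying S, which is injective and reverses products, turns this into x_(1) S(x_(2)) = eps(x)
    1. *)
Lemma antipode_invr x : tlift (fun a b => b * Si a) (comul X x) = (counit X x)%:A.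
Proof.
have Sl := antipode_inv_linear; apply: (can_inj (@antipodeK k X)).
rewrite [RHS]linearZ /= antipode1 -antipoder.
rewrite (tlift_comp (h := antipode X)); [|by linr|by linr].
by apply: eq_tlift => a b; rewrite antipodeM antipode_invK.
Qed.

End AntipodeInv.

Lemma fd1 (k : fieldType) (A : algType k) (OA : calculus A) : fd OA 1 = 0.
Proof.
have := fd_leibniz (c := OA) 1 (finc_deg0 OA 1).
rewrite !rmorph1 !mulr1 expr0 scale1r mul1r => /eqP.
by rewrite -subr_eq subrr eq_sym => /eqP.
Qed.

(** * Forms on the base *)

Section Kernel.
Variables (k : fieldType) (X H : hopfAlg k) (OX : bicovariant X) (OH : bicovariant H).
Variable pi : diff_map OX OH.
Hypothesis pi_hopf : hopf_map pi.

Local Notation fi := (finc OX).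
Local Notation D := (comul X).
Local Notation lc := (@lcoact k X OX).
Local Notation ps := (dform pi).

Lemma hcoact_linear : linear (hcoact pi).
Proof. by move=> a u v; rewrite /hcoact /= !linearP. Qed.

Lemma coinvP b : b \in coinv pi -> tmap idfun pi (D b) = b ⊗ 1.
Proof. by move/eqP. Qed.

(* The inverse of eta ⊗ h |-> eta h for left-invariant eta, followed by the   *)
(* counit of H.                                                               *)
Definition linv_part (v : OH) : OH :=
  tlift (fun h w => w * finc OH (antipode_inv h)) (lcoact v).

Lemma linv_part_linear : linear linv_part.
Proof. by have Sl := @antipode_inv_linear k H; rewrite /linv_part; linr. Qed.

Lemma linv_partE n v h : linv (OX := OH) n v ->
  linv_part (v * finc OH h) = counit H h *: v.
Proof.
have Sl := @antipode_inv_linear k H.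
move=> [_ vl]; rewrite /linv_part lcoactM vl lcoact_inc.
rewrite [LHS](tlift_tmk (f := fun t => tlift (fun h w => w * finc OH (antipode_inv h))
  (tmul (1 ⊗ v) (tmap idfun (finc OH) t)))); last by linr.
rewrite -[RHS]mulr1 -scalerAl scalerAr -(rmorph1 (finc OH)) -linearZ -antipode_invr.
rewrite (tlift_comp (h := fun x => v * finc OH x)); [|by linr|by linr].
apply: eq_tlift => a b; rewrite tmapE tmulE tliftE; last by linr.
by rewrite mul1r /= rmorphM mulrA.
Qed.

Definition kerX : set OX :=
  lin_comb [set val xi * fi x | xi in ker_pi pi & x in [set: X]].

(* For w = xi x the hypothesis reads x_1 ⊗ pi_*(xi) pi(x_2) = 0, which        *)
(* [linv_part] turns into pi_*(xi) ⊗ x = 0.                                   *)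
Lemma kerX_intro w : formn OX 1 w -> tmap idfun ps (lc w) = 0 -> kerX w.
Proof.
move=> w1 w0.
have vl := @L1_val_linear k X OX.
have mb : bilinear_map (fun (xi : L1 OX) x => val xi * fi x) by linr.
have [t tw] : exists t : L1 OX ⊗ X, tlift (fun xi x => val xi * fi x) t = w.
  move: (w) (form_span w1).
  apply: lin_comb_le => [_ [v [v1 vl'] [x _ <-]]||a u v [s <-] [t <-]].
  - by have [xi <-] := L1_intro v1 vl'; exists (xi ⊗ x); rewrite (tliftE mb).
  - by exists 0; rewrite (lin_zero (tlift_linear mb)).
  - by exists (a *: s + t); rewrite (tlift_linear mb).
have fl : linear (fun xi : L1 OX => ps (val xi)) by linr.
have rl := linv_part_linear.
(* Over a field this vanishing puts t in K ⊗ X, by [tmap_ker]. *)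
have : tmap (lmk fl) (idfun : {linear X -> X}) t = 0.
  transitivity (tlift (fun x v => linv_part v ⊗ x) (tmap idfun ps (lc w))); last first.
    by rewrite w0 lin_zero //; linr.
  rewrite -tw; move: t {tw}; apply: tensor_ext => [||xi x]; [linr|linr|].
  have [xi1 xil] := L1P xi.
  have pxi : linv (OX := OH) 1 (ps (val xi)).
    split; first by rewrite /formn /= -dform_comp xi1.
    by rewrite (lcoact_dform pi_hopf) xil tmapE rmorph1.
  rewrite (tliftE mb) tmapE lcoactM xil lcoact_inc /=.
  rewrite [RHS](tlift_tmk (f := fun t => tlift (fun x v => linv_part v ⊗ x)
    (tmap idfun ps (tmul (1 ⊗ val xi) (tmap idfun fi t))))); last by linr.
  rewrite -[LHS](counit_comr (f := fun x => ps (val xi) ⊗ x)); last by linr.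
  apply: eq_tlift => a b; rewrite tmapE tmulE tmapE tliftE; last by linr.
  by rewrite dformM dform_inc (linv_partE _ pxi) mul1r /= tmkZl pi_hopf.2.
move/tmap_ker; rewrite -tw; apply: lin_comb_map; first exact: tlift_linear.
move=> _ [xi /= xi0 [x _ <-]]; rewrite (tliftE mb); apply: lin_comb_gen.
by exists xi => //; exists x.
Qed.

(** Pushed to H, the left coaction of db is b_(1) ⊗ d pi(b_(2)) = b ⊗ d1 = 0. *)
Lemma kerX_d b : b \in coinv pi -> kerX (fd OX (fi b)).
Proof.
move=> /coinvP bP; apply: kerX_intro; first by apply: fd_deg; exact: finc_deg0.
rewrite lcoact_d lcoact_inc.
transitivity (tmap idfun (fd OH \o finc OH) (tmap idfun pi (D b))).
  move: (D b); apply: tensor_ext => [||x y]; [linr|linr|].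
  by rewrite !tmapE /= dform_d dform_inc.
by rewrite bP tmapE /= rmorph1 fd1 tmk0r.
Qed.

Lemma kerX_mulr w x : kerX w -> kerX (w * fi x).
Proof.
apply: (lin_comb_map (f := fun w => w * fi x)); first by linr.
move=> _ [xi xi0 [y _ <-]]; apply: lin_comb_gen; exists xi => //.
by exists (y * x); rewrite ?rmorphM ?mulrA.
Qed.

Lemma kerX_mull w x : kerX w -> kerX (fi x * w).
Proof.
apply: (lin_comb_map (f := fun w => fi x * w)); first by linr.
move=> _ [xi xi0 [y _ <-]]; rewrite mulrA; apply: kerX_mulr; apply: kerX_intro.
  by apply: (fmul_deg (finc_deg0 OX x)); exact: (L1P xi).1.
rewrite lcoactM (L1P xi).2 lcoact_inc.
move: (D x); apply: (tensor_ext (g := fun _ => 0)) => [||a b]; [linr| |].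
  by move=> a u v; rewrite scaler0 addr0.
by rewrite tmapE tmulE tmapE dformM (xi0 : ps (val xi) = 0) mulr0 tmk0r.
Qed.

End Kernel.

Section BaseForms.
Variables (k : fieldType) (X H : hopfAlg k) (OX : bicovariant X) (OH : bicovariant H).
Variable pi : diff_map OX OH.
Hypotheses (pi_hopf : hopf_map pi) (condK : conditionK pi).

Local Notation fi := (finc OX).
Local Notation B := (coinv pi).

Fixpoint ker_prod (n : nat) : set OX :=
  match n with
  | 0 => [set 1]
  | n'.+1 => [set val xi * p | xi in ker_pi pi & p in ker_prod n']
  end.

(** [ker_prod] grows on the left, like [wedge_prod], whereas [sub_formn] grows on the right; this
    lemma and the next one translate between the two. *)
Lemma ker_prod_rcons n p xi : ker_prod n p -> ker_pi pi xi ->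
  ker_prod n.+1 (p * val xi).
Proof.
elim: n p => [p ->|n IH p [eta eta0 [q qn <-]]] xi0.
  by exists xi => //; exists 1; rewrite ?mulr1 ?mul1r.
by exists eta => //; exists (q * val xi); [exact: IH|rewrite mulrA].
Qed.

Lemma ker_prod_lastP n q : ker_prod n.+1 q ->
  exists p xi, [/\ ker_prod n p, ker_pi pi xi & q = p * val xi].
Proof.
elim: n q => [|n IH] q [eta eta0 [p pn <-]].
  by exists 1, eta; split=> //; rewrite pn mulr1 mul1r.
have [p' [xi [p'n xi0 ->]]] := IH _ pn.
by exists (val eta * p'), xi; split=> //; [exists eta => //; exists p'|rewrite mulrA].
Qed.

Lemma wedge_prod_ker n t : tpow_pure (ker_pi pi) n t -> ker_prod n (wedge_prod t).
Proof.
elim: n t => [t ->|n IH _ [xi xi0 [t tn <-]]]; first by rewrite /= scale1r.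
by rewrite wedge_prodS; exists xi => //; exists (wedge_prod t) => //; exact: IH.
Qed.

Lemma ker_prod_wedge n p : ker_prod n p ->
  exists2 t, tpow_pure (ker_pi pi) n t & wedge_prod t = p.
Proof.
elim: n p => [p ->|n IH _ [xi xi0 [p pn <-]]].
  by exists (1 : k^o) => //; rewrite /= scale1r.
have [t tn <-] := IH _ pn; exists (xi ⊗ t); last by rewrite wedge_prodS.
by exists xi => //; exists t.
Qed.

Definition kerX_prod n : set OX :=
  lin_comb [set p * fi x | p in ker_prod n & x in [set: X]].

Definition baseX n : set OX :=
  lin_comb [set w * fi x | w in sub_formn B n & x in [set: X]].

Lemma baseX_mulr n w x : baseX n w -> baseX n (w * fi x).
Proof.
apply: (lin_comb_map (f := fun w => w * fi x)); first by linr.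
move=> _ [v vB [y _ <-]]; apply: lin_comb_gen; exists v => //.
by exists (y * x); rewrite ?rmorphM ?mulrA.
Qed.

Lemma sub_formn_baseX n w : sub_formn B n w -> baseX n w.
Proof.
move=> wB; apply: lin_comb_gen.
by exists w => //; exists 1; rewrite ?rmorph1 ?mulr1.
Qed.

Lemma kerX_prodM n w z : kerX_prod n w -> kerX pi z -> kerX_prod n.+1 (w * z).
Proof.
move=> wn zK; move: w wn.
apply: (lin_comb_map (f := fun w => w * z)) => [|_ [p pn [x _ <-]]]; first by linr.
rewrite -mulrA; move: (fi x * z) (kerX_mull pi_hopf x zK).
apply: (lin_comb_map (f := fun w => p * w)) => [|_ [xi xi0 [y _ <-]]]; first by linr.
rewrite mulrA; apply: lin_comb_gen; exists (p * val xi); last by exists y.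
exact: ker_prod_rcons.
Qed.

Lemma sub_form1_kerX z : sub_form1 B z -> kerX pi z.
Proof.
move: z; apply: (lin_comb_map (f := fun z => z)) => [|_ [b _ [c cB <-]]]; first by linr.
by apply: kerX_mull => //; exact: kerX_d.
Qed.

Lemma sub_formn_kerX n w : sub_formn B n w -> kerX_prod n w.
Proof.
elim: n w => [_ [b bB <-]|n IH].
  apply: lin_comb_gen; exists 1 => //.
  by exists b => //; rewrite mul1r.
apply: (lin_comb_map (f := fun z => z)) => [|_ [u un [z z1 <-]]]; first by linr.
by apply: kerX_prodM; [exact: IH|exact: sub_form1_kerX].
Qed.

(** [kerX_mull] moves X past K, and condition K then replaces K by dB.X next to the form on B. *)
Lemma baseXM n w z : baseX n w -> kerX pi z -> baseX n.+1 (w * z).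
Proof.
move=> wn zK; move: w wn.
apply: (lin_comb_map (f := fun w => w * z)) => [|_ [p pn [x _ <-]]]; first by linr.
rewrite -mulrA; move: (fi x * z) (kerX_mull pi_hopf x zK).
apply: (lin_comb_map (f := fun w => p * w)) => [|_ [xi xi0 [y _ <-]]]; first by linr.
rewrite mulrA; apply: baseX_mulr; move: (val xi) (lspanP _ _ (condK xi0)).
apply: (lin_comb_map (f := fun w => p * w)) => [|_ [b bB [x' _ <-]]]; first by linr.
rewrite mulrA; apply: baseX_mulr; apply: sub_formn_baseX.
by apply: sub_formn1M => //; exact: sub_form1_d.
Qed.

Lemma ker_prod_baseX n p : ker_prod n p -> baseX n p.
Proof.
elim: n p => [p ->|n IH q /ker_prod_lastP[p [xi [pn xi0 ->]]]].
  by apply: sub_formn_baseX; exists 1; rewrite ?rmorph1 //; exact: rpred1.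
apply: baseXM; first exact: IH.
by apply: lin_comb_gen; exists xi => //; exists 1; rewrite ?rmorph1 ?mulr1.
Qed.

Lemma kerX_prod_baseX n w : kerX_prod n w -> baseX n w.
Proof.
move: w; apply: (lin_comb_map (f := fun w => w)) => [|_ [p pn [x _ <-]]]; first by linr.
by apply: baseX_mulr; exact: ker_prod_baseX.
Qed.

End BaseForms.

(** * Averaging over H with the integral *)

Section Averaging.
Variables (k : fieldType) (X H : hopfAlg k) (pi : {lrmorphism X -> H}).
Hypothesis pi_hopf : hopf_map pi.
Variables (I : {linear H -> k^o}) (I_int : normalised_left_integral I).

Local Notation D := (comul X).

Definition coinv_avg (x : X) : X := tlift (fun a b => I (pi b) *: a) (D x).

Lemma lin_integral (V U : lmodType k) (v : V) (f : U -> H) :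
  linear f -> linear (fun u => I (f u) *: v).
Proof. by move=> fl a x y; rewrite fl linearP scalerDl -scalerA. Qed.

Lemma coinv_avg_bilinear : bilinear_map (fun a b : X => I (pi b) *: a).
Proof. by split=> ?; [exact: lin_scaler|apply: lin_integral; linr]. Qed.

Lemma coinv_avg_linear : linear coinv_avg.
Proof. by have ib := coinv_avg_bilinear; rewrite /coinv_avg; linr. Qed.

(** The coaction of the average is x_(1) ⊗ pi(x_(2)) ∫pi(x_(3)), and left invariance of the integral
    reduces it to x_(1) ⊗ 1 ∫pi(x_(2)). *)
Lemma coinv_avgP x : coinv_avg x \in coinv pi.
Proof.
have ib := coinv_avg_bilinear; apply/eqP.
have hl : linear (hcoact pi) by move=> a u v; rewrite /hcoact /= !linearP.
pose f (a b c : X) := (I (pi c) : k) *: (a ⊗ pi b) : X ⊗ H.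
have ft : trilinear_map f.
  by split=> ? ?; rewrite /f; first [by linr | apply: lin_integral; linr].
rewrite /coinv_avg (tlift_comp (h := hcoact pi)) //.
rewrite (tlift_comp (h := fun y => y ⊗ 1)) //; last by linr.
transitivity (tlift (fun a c => tlift (fun a' b => f a' b c) (D a)) (D x)).
  apply: eq_tlift => a c; rewrite (linZ hl) /hcoact /=.
  rewrite [LHS](tlift_tmk (f := fun t => (I (pi c) : k) *: tmap idfun pi t));
    last by linr.
  by apply: eq_tlift => a' b; rewrite tmapE.
rewrite comul_coassoc //; apply: eq_tlift => a b.
have jb : bilinear_map (fun g g' : H => I g' *: g).
  by split=> ?; [exact: lin_scaler|apply: lin_integral; linr].
rewrite tmkZl -tmkZr -I_int.1 pi_hopf.1 tlift_tmap //.
rewrite (tlift_comp (h := fun y => a ⊗ y)); [|by linr|].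
  by apply: eq_tlift => c d; rewrite tmkZr.
by split=> ?; [apply: lin_scaler; linr|apply: lin_integral; linr].
Qed.

Lemma coinv_avg_id b : b \in coinv pi -> coinv_avg b = b.
Proof.
move=> /eqP bP.
have jb : bilinear_map (fun (a : X) (h : H) => I h *: a).
  by split=> ?; [exact: lin_scaler|apply: lin_integral; linr].
have := congr1 (tlift (fun (a : X) h => I h *: a)) bP.
by rewrite /hcoact /= tlift_tmap // tliftE // I_int.2 scale1r.
Qed.

(** This is the usable form of Delta B ⊂ X ⊗ B: the second leg may be replaced by its average, which
    lies in B. By coassociativity the left side is Delta of the average of b, and b is its own
    average. *)
Lemma coinv_comul b : b \in coinv pi -> tmap idfun (lmk coinv_avg_linear) (D b) = D b.
Proof.
move=> bB; have ib := coinv_avg_bilinear.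
pose f (a b c : X) := (I (pi c) : k) *: (a ⊗ b) : X ⊗ X.
have ft : trilinear_map f.
  by split=> ? ?; rewrite /f; first [by linr | apply: lin_integral; linr].
transitivity (tlift (fun a b => tlift (f a) (D b)) (D b)).
  rewrite [LHS](tlift_tmk (f := fun t => tmap idfun (lmk coinv_avg_linear) t));
    last by linr.
  apply: eq_tlift => a c; rewrite tmapE /= /coinv_avg.
  rewrite (tlift_comp (h := fun y => a ⊗ y)) //; last by linr.
  by apply: eq_tlift => u v; rewrite tmkZr.
rewrite -comul_coassoc // -[in RHS](coinv_avg_id bB).
rewrite (tlift_comp (h := D)) //; last by linr.
apply: eq_tlift => a c; rewrite linearZ /=.
rewrite [RHS](tlift_tmk (f := fun t => (I (pi c) : k) *: t)); last by linr.
by apply: eq_tlift.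
Qed.

End Averaging.

Section FormCoaction.
Variables (k : fieldType) (X H : hopfAlg k) (OX : bicovariant X) (OH : bicovariant H).
Variable pi : diff_map OX OH.
Hypothesis pi_hopf : hopf_map pi.
Variables (I : {linear H -> k^o}) (I_int : normalised_left_integral I).

Local Notation fi := (finc OX).
Local Notation B := (coinv pi).
Local Notation D := (comul X).
Local Notation rc := (@rcoact k X OX).

Definition rho (w : OX) : OX ⊗ H := tmap idfun pi (rc w).

Lemma rho_linear : linear rho.
Proof. by rewrite /rho; linr. Qed.

Lemma rhoM w z : rho (w * z) = tmul (rho w) (rho z).
Proof. by rewrite /rho rcoactM (tmap_tmul idfun pi). Qed.

Lemma rho_inc x : rho (fi x) = tmap fi idfun (hcoact pi x).
Proof.
rewrite /rho rcoact_inc /hcoact /=; move: (D x).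
by apply: tensor_ext => [||a b]; [linr|linr|rewrite !tmapE].
Qed.

Lemma rho_d w : rho (fd OX w) = tmap (fd OX) idfun (rho w).
Proof.
rewrite /rho rcoact_d; move: (rc w).
by apply: tensor_ext => [||a b]; [linr|linr|rewrite !tmapE].
Qed.

Lemma rho_sub_form1 w : sub_form1 B w -> rho w = w ⊗ 1.
Proof.
have rl := rho_linear.
move: w; apply: lin_comb_eq => [||_ [b bB [c cB <-]]]; [by []|linr|].
rewrite rhoM rho_inc rho_d rho_inc /hcoact /= (coinvP bB) (coinvP cB).
by rewrite !tmapE tmulE mulr1.
Qed.

Lemma rho_sub_formn n w : sub_formn B n w -> rho w = w ⊗ 1.
Proof.
have rl := rho_linear.
elim: n w => [_ [b bB <-]|n IH].
  by rewrite rho_inc /hcoact /= (coinvP bB) tmapE.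
apply: lin_comb_eq => [||_ [u un [z z1 <-]]]; [by []|linr|].
by rewrite rhoM (IH _ un) (rho_sub_form1 z1) tmulE mulr1.
Qed.

Definition form_avg (w : OX) : OX := tlift (fun v h => (I h : k) *: v) (rho w).

Lemma form_avg_bilinear : bilinear_map (fun (v : OX) (h : H) => (I h : k) *: v).
Proof. by split=> ?; [exact: lin_scaler|apply: lin_integral; linr]. Qed.

Lemma form_avg_linear : linear form_avg.
Proof.
have fb := form_avg_bilinear; have rl := rho_linear.
by rewrite /form_avg; linr.
Qed.

Lemma form_avg_id w : rho w = w ⊗ 1 -> form_avg w = w.
Proof.
have fb := form_avg_bilinear.
by move=> ww; rewrite /form_avg ww tliftE // I_int.2 scale1r.
Qed.

Lemma form_avg_mulr w x : rho w = w ⊗ 1 ->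
  form_avg (w * fi x) = w * fi (coinv_avg pi I x).
Proof.
have fb := form_avg_bilinear; have ib := coinv_avg_bilinear pi I.
move=> ww; rewrite /form_avg rhoM ww rho_inc /hcoact /= /coinv_avg.
rewrite (tlift_comp (h := fun y => w * fi y)) //; last by linr.
rewrite [LHS](tlift_tmk (f := fun t => tlift (fun v h => (I h : k) *: v)
  (tmul (w ⊗ 1) (tmap fi idfun (tmap idfun pi t))))); last by linr.
apply: eq_tlift => a b; rewrite !tmapE tmulE tliftE // mul1r /=.
by rewrite linearZ -scalerAr.
Qed.

Lemma form_avg_baseM w b : b \in B -> form_avg (w * fi b) = form_avg w * fi b.
Proof.
have fb := form_avg_bilinear.
move=> bB; rewrite /form_avg rhoM rho_inc /hcoact /= (coinvP bB) tmapE.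
move: (rho w); apply: tensor_ext => [||v h]; [linr|linr|].
by rewrite tmulE !tliftE //= mulr1 scalerAl.
Qed.

(** The average of omega x is omega times the average of x, an element of B. *)
Lemma form_avg_baseX n w : baseX pi n w -> sub_formn B n (form_avg w).
Proof.
have fl := form_avg_linear.
elim=> [|a u v [z zn [x _ <-]] _ IH]; first by rewrite lin_zero //; exact: sub_formn0.
rewrite fl; apply: sub_formn_lin IH.
rewrite form_avg_mulr; last exact: rho_sub_formn zn.
by apply: sub_formn_mulr => //; exact: coinv_avgP.
Qed.

End FormCoaction.

(** * The H-coaction on wedge powers *)

Section TensorCoaction.
Variables (k : fieldType) (V W : lmodType k) (C : algType k).
Variables (f : V -> V ⊗ C) (g : W -> W ⊗ C).
Hypotheses (fl : linear f) (gl : linear g).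

Lemma tcoact_bilinear : bilinear_map (fun (v : V) (w : W) =>
  tlift (fun (v0 : V) (c : C) =>
    tlift (fun (w0 : W) (c' : C) => (v0 ⊗ w0) ⊗ (c * c')) (g w)) (f v)).
Proof. by linr. Qed.

Lemma tcoact_linear : linear (tcoact f g).
Proof. exact: (tlift_linear tcoact_bilinear). Qed.

(** A map m that multiplies the images of p and q turns the diagonal coaction into a product of
    coactions. It serves twice: for [wedge_prod] on tensor powers and for [wedge_form]. *)
Lemma tcoact_mul (A : algType k) (m : V ⊗ W -> A) (p : {linear V -> A})
    (q : {linear W -> A}) (ml : linear m) v w :
  (forall v w, m (v ⊗ w) = p v * q w) ->
  tmap (lmk ml) idfun (tcoact f g (v ⊗ w)) =
  tmul (tmap p idfun (f v)) (tmap q idfun (g w)).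
Proof.
move=> mE; rewrite /tcoact (tliftE tcoact_bilinear).
move: (f v) (g w) => s t.
move: s; apply: tensor_ext => [||v0 c]; [linr|linr|].
move: t; apply: tensor_ext => [||w0 c']; [linr|linr|].
rewrite tliftE; last by linr.
by rewrite tliftE ?tmapE ?tmulE /= ?mE //; linr.
Qed.

End TensorCoaction.

Section WedgeCoaction.
Variables (k : fieldType) (X H : hopfAlg k) (OX : bicovariant X) (OH : bicovariant H).
Variable pi : diff_map OX OH.

Local Notation fi := (finc OX).
Local Notation rc := (@rcoact k X OX).
Local Notation L1v := (lmk (@L1_val_linear k X OX)).

(* Both coactions on 1-forms commute, so rcoact xi lies in the kernel of      *)
(* (w |-> lcoact w - 1 ⊗ w) ⊗ id, which is L1 ⊗ X over a field.               *)
Lemma L1_coactP xi : tmap L1v idfun (L1_coact xi) = rc (val xi).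
Proof.
suff [t tE] : exists t, tmap L1v idfun t = rc (val xi).
  exact: (@xgetPex _ 0 [set t | tmap (val : L1 OX -> OX) idfun t = rc (val xi)]
    (ex_intro _ t tE)).
have [xi1 xil] := L1P xi.
set r := rc (val xi).
have r1 : tmap (fcomp OX 1) idfun r = r by rewrite -rcoact_comp xi1.
have fl : linear (fun w : OX => lcoact w + (-1) *: (1 ⊗ w)) by linr.
have al : linear (@tassoc k X OX X) by rewrite /tassoc; linr.
have tassoc_inj : injective (@tassoc k X OX X).
  apply: (@can_inj _ _ _ (tlift (fun u t => tlift (fun v w => (u ⊗ v) ⊗ w) t))).
  apply: tensor_ext => [||s w]; [linr|linr|].
  move: s; apply: tensor_ext => [||u v]; [linr|linr|].
  by rewrite tassocE !tliftE //; linr.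
have r0 : tmap (lmk fl) idfun r = 0.
  have rE s : tassoc (tmap (lmk fl) (idfun : {linear X -> X}) s) =
      tassoc (tmap (@lcoact k X OX) idfun s) + (-1) *: (1 ⊗ s).
    move: s; apply: tensor_ext => [||w x]; [linr|linr|].
    by rewrite !tmapE /= tmkDl tmkZl (linD al) (linZ al) tassocE.
  apply: tassoc_inj; rewrite rE lrcoact_compat xil tmapE /= scaleN1r subrr.
  by rewrite (lin_zero al).
(* [tmap_ker] yields invariant forms w of any degree. Their degree 1 components lie in L1, and r is
   unchanged by that projection. *)
have := tmap_ker r0; rewrite -{2}r1.
elim=> [|a _ s [w /= w0 [x _ <-]] _ [t tE]]; first by exists 0; rewrite !tmap0.
have wl : lcoact (fcomp OX 1 w) = 1 ⊗ fcomp OX 1 w.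
  move/eqP: w0; rewrite scaleN1r subr_eq0 => /eqP w0.
  by rewrite lcoact_comp w0 tmapE.
have [eta etaE] : exists eta, L1v eta = fcomp OX 1 w := L1_intro (fcompK 1 1 w) wl.
exists (a *: (eta ⊗ x) + t).
transitivity (a *: tmap L1v (idfun : {linear X -> X}) (eta ⊗ x) + tmap L1v idfun t).
  exact (tmapP L1v idfun a (eta ⊗ x) t).
by rewrite tE !tmapP !tmapE etaE.
Qed.

Lemma L1_val_inj : injective L1v.
Proof. exact: val_inj. Qed.

(** The value is picked by [xget]; linearity is read off in OX ⊗ X through the injection of L1 ⊗
    X. *)
Lemma L1_coact_linear : linear (@L1_coact k X OX).
Proof.
move=> a u v; apply: (tmap_inj (W := X) L1_val_inj).
have cl : linear (fun xi : L1 OX => rc (val xi)) by exact: lin_pack.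
by rewrite (tmapP L1v idfun) !L1_coactP cl.
Qed.

Lemma L1_hcoact_linear : linear (L1_hcoact pi).
Proof. by have cl := L1_coact_linear; rewrite /L1_hcoact; linr. Qed.

Lemma L1_hcoactP xi : tmap L1v idfun (L1_hcoact pi xi) = rho pi (val xi).
Proof.
rewrite /rho -L1_coactP /L1_hcoact; move: (L1_coact xi).
by apply: tensor_ext => [||a b]; [linr|linr|rewrite !tmapE].
Qed.

Local Notation wp n := (lmk (@wedge_prod_linear k X OX n)).

Lemma tpow_coact_linear n : linear (@tpow_coact k (L1 OX) H (L1_hcoact pi) n).
Proof.
elim: n => [|n IH]; first by move=> a u v; rewrite /= tmkDl tmkZl.
exact: (tcoact_linear L1_hcoact_linear IH).
Qed.

Lemma tpow_coactP n t :
  tmap (wp n) idfun (tpow_coact (L1_hcoact pi) t) = rho pi (wedge_prod t).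
Proof.
have rl := rho_linear pi.
elim: n t => [|n IH] t.
  have -> : wedge_prod t = t *: fi 1 by rewrite rmorph1.
  have -> : tpow_coact (L1_hcoact pi) t = t ⊗ 1 by [].
  rewrite tmapE (linZ rl) rho_inc /hcoact /= comul1 !tmapE /=.
  by rewrite -tmkZl !rmorph1.
have cl := @tpow_coact_linear n.+1; have wl := @wedge_prod_linear k X OX n.+1.
move: t; apply: tensor_ext => [||xi t]; [exact: lin_pack|exact: (lin_comp rl wl)|].
rewrite wedge_prodS rhoM -IH -L1_hcoactP.
apply: (tcoact_mul L1_hcoact_linear (@tpow_coact_linear n)) => v w.
exact: wedge_prodS.
Qed.

Local Notation ql n := (lmk (qlift_linear (@wedge_prod_linear k X OX n)
  (@wedge_prod_rel k X OX n))).

(** [wedge_form] is injective on the elements q ⊗ 1, and the counit recovers q from q ⊗ 1. *)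
Lemma wedge_inj n : injective (ql n).
Proof.
have [_ inj _] := bic_woronowicz OX n; move=> p q pq.
have : p ⊗ 1 = q ⊗ 1 :> wedge OX n ⊗ X.
  by apply: inj; rewrite !wedge_formE; congr (_ * _).
have eb : bilinear_map (fun (q : wedge OX n) (x : X) => (counit X x : k) *: q).
  by split=> ? /=; [exact: lin_scaler|move=> a u v; rewrite linearP scalerDl -scalerA].
move/(congr1 (tlift (fun (q : wedge OX n) (x : X) => (counit X x : k) *: q))).
by rewrite !(tliftE eb) rmorph1 !scale1r.
Qed.

Lemma wedge_hcoactP n q :
  tmap (ql n) idfun (wedge_hcoact pi q) = rho pi (qlift (@wedge_prod k X OX n) q).
Proof.
transitivity (rho pi (wedge_prod (repr q))); last by [].
rewrite -tpow_coactP (_ : wedge_hcoact pi q =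
  tmap (lclass _) idfun (tpow_coact (L1_hcoact pi) (repr q))) //.
move: (tpow_coact _ _); apply: tensor_ext => [||t h]; [linr|linr|].
rewrite !tmapE; congr (_ ⊗ _).
exact: (qlift_class (@wedge_prod_linear k X OX n) (@wedge_prod_rel k X OX n)).
Qed.

(** Compatibility of the coaction with [braid_rel] is never checked on relations: the wedge power
    embeds in OX, where the map becomes the linear map [rho]. *)
Lemma wedge_hcoact_linear n : linear (@wedge_hcoact k X H OX OH pi n).
Proof.
have rl := rho_linear pi; move=> a p q; apply: (tmap_inj (W := H) (@wedge_inj n)).
rewrite (tmapP (ql n) idfun) !wedge_hcoactP -rl; congr (rho pi _).
exact: (linearP (ql n)).
Qed.

Lemma wedge_form_hcoactP n u :
  tmap (lmk (@wedge_form_linear k X OX n)) idfun (wedge_form_hcoact pi u) =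
  rho pi (wedge_form u).
Proof.
have rl := rho_linear pi; have wl := @wedge_form_linear k X OX n.
have cl : linear (@wedge_form_hcoact k X H OX OH pi n).
  exact: (tcoact_linear (@wedge_hcoact_linear n) (hcoact_linear pi)).
move: u; apply: tensor_ext => [||q x]; [exact: lin_pack|exact: (lin_comp rl wl)|].
rewrite wedge_formE rhoM -wedge_hcoactP rho_inc.
apply: (tcoact_mul (@wedge_hcoact_linear n) (hcoact_linear pi)) => v w.
exact: wedge_formE.
Qed.

End WedgeCoaction.

Section SubCalculusForms.
Variables (k : fieldType) (A : algType k) (OA : calculus A) (S : subalgClosed A).

Lemma sub_calculusP n (w : sub_calculus OA S) :
  formn (sub_calculus OA S) n w <-> sub_formn (OA := OA) S n (val w).
Proof.
split=> [/scompP nw|/sub_formn_deg nw]; last exact/scompP.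
exact: (sub_form_formn (valP w)).
Qed.

Lemma sub_calculus_intro n v : sub_formn (OA := OA) S n v ->
  exists2 w : sub_calculus OA S, formn (sub_calculus OA S) n w & val w = v.
Proof.
by move=> vn; exists (SubAlg (sub_formn_form vn)) => //; apply/sub_calculusP.
Qed.

End SubCalculusForms.

(** * Forms on B as coinvariants of K^n.X *)

Section CoinvariantForms.
Variables (k : fieldType) (X H : hopfAlg k) (OX : bicovariant X) (OH : bicovariant H).
Variable pi : diff_map OX OH.
Hypotheses (pi_hopf : hopf_map pi) (condK : conditionK pi).
Variables (I : {linear H -> k^o}) (I_int : normalised_left_integral I).

Lemma kerX_prodP n w : kerX_prod pi n w <->
  exists2 u, u \in lspan [set lclass (@braid_rel k X OX n) t ⊗ x |
    t in tpow_pure (ker_pi pi) n & x in [set: X]] & wedge_form u = w.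
Proof.
have wl := @wedge_form_linear k X OX n.
split=> [|[u /lspanP uK <-]].
  elim=> [|a _ v [p /ker_prod_wedge[t tn <-] [x _ <-]] _ [u uK <-]].
    by exists 0; [exact: rpred0|exact: lin_zero].
  exists (a *: (lclass _ t ⊗ x) + u); last by rewrite wl wedge_form_class.
  by rewrite rpredD // rpredZ // sub_lspan //; exists t => //; exists x.
move: u uK; apply: lin_comb_map => // _ [t tn [x _ <-]].
rewrite wedge_form_class; apply: lin_comb_gen.
by exists (wedge_prod t); [exact: wedge_prod_ker|exists x].
Qed.

Lemma sub_formnE n w : sub_formn (coinv pi) n w <->
  exists2 u, kerX_coinv pi n u & wedge_form u = w.
Proof.
split=> [wn|[u [uK u1] <-]].
  have [u uK uw] := (kerX_prodP n w).1 (sub_formn_kerX pi_hopf wn).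
  exists u => //; split=> //.
  (* Coinvariance of u is tested after the injective map [wedge_form] ⊗ id, where it says that w is
     fixed by [rho]. *)
  have [_ inj _] := bic_woronowicz OX n.
  apply: (tmap_inj (f := lmk (@wedge_form_linear k X OX n)) inj).
  by rewrite wedge_form_hcoactP uw (rho_sub_formn wn) tmapE /= uw.
have uX : kerX_prod pi n (wedge_form u) by apply/kerX_prodP; exists u.
have := form_avg_baseX pi_hopf I_int (kerX_prod_baseX pi_hopf condK uX).
rewrite (form_avg_id I_int) // -wedge_form_hcoactP.
by rewrite (u1 : wedge_form_hcoact pi u = u ⊗ 1) tmapE.
Qed.

Lemma coinvariant_forms n :
  [set dm_form (sub_inclusion OX (coinv pi)) w |
    w in formn (sub_calculus OX (coinv pi)) n] =
  [set wedge_form u | u in kerX_coinv pi n].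
Proof.
apply/seteqP; split=> w.
  by case=> v /sub_calculusP vn <-; apply/sub_formnE.
by move=> /= /sub_formnE /sub_calculus_intro[v vn <-]; exists v.
Qed.

End CoinvariantForms.

(** * The coproduct of a form on the base *)

Section BaseComul.
Variables (k : fieldType) (X H : hopfAlg k) (OX : bicovariant X) (OH : bicovariant H).
Variable pi : diff_map OX OH.
Hypothesis pi_hopf : hopf_map pi.
Variables (I : {linear H -> k^o}) (I_int : normalised_left_integral I).

Local Notation fi := (finc OX).
Local Notation B := (coinv pi).
Local Notation D := (comul X).
Local Notation avg := (coinv_avg pi I).
Local Notation pm := (@pmul k (tensor_dga (dga_of OX) (dga_of OX))).

Lemma coinv_comul_tlift (Z : lmodType k) (G : X -> X -> Z) b : bilinear_map G ->
  b \in B -> tlift G (D b) = tlift (fun a c => G a (avg c)) (D b).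
Proof.
by move=> Gb bB; rewrite -{1}(coinv_comul I_int bB) tlift_tmap.
Qed.

(* F vanishes on OX ⊗ J for J the right ideal generated by B^+ and dB.        *)
Definition kills_base (Z : lmodType k) (F : OX ⊗ OX -> Z) :=
  (forall u b z, b \in B -> counit X b = 0 -> F (u ⊗ (fi b * z)) = 0) /\
  (forall u b z, b \in B -> F (u ⊗ (fd OX (fi b) * z)) = 0).

Definition lmul_left (w : OX) (t : OX ⊗ OX) : OX ⊗ OX :=
  tlift (fun u v => (w * u) ⊗ v) t.

Lemma lmul_leftE w u v : lmul_left w (u ⊗ v) = (w * u) ⊗ v.
Proof. by rewrite /lmul_left tliftE //; linr. Qed.

Lemma lmul_left_bilinear : bilinear_map lmul_left.
Proof. by rewrite /lmul_left; linr. Qed.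

Lemma kills_base_lmul (Z : lmodType k) (F : OX ⊗ OX -> Z) w :
  kills_base F -> kills_base (fun t => F (lmul_left w t)).
Proof. by move=> [F1 F2]; split=> *; rewrite lmul_leftE ?F1 ?F2. Qed.

(** b - eps(b) 1 lies in B^+, so modulo J left multiplication by b is multiplication by eps(b). *)
Lemma kills_base_counit (Z : lmodType k) (F : OX ⊗ OX -> Z) u b z :
  linear F -> kills_base F -> b \in B ->
  F (u ⊗ (fi b * z)) = counit X b *: F (u ⊗ z).
Proof.
move=> Fl [F1 _] bB; set e := counit X b.
have -> : fi b * z = fi (b - e *: 1) * z + e *: z.
  by rewrite linearB linearZ /= rmorph1 mulrBl -scalerAl mul1r subrK.
have bB' : b - e *: 1 \in B.
  have [B1 Bl _] := coinv_subalg_closed pi.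
  by have := Bl (- e) _ _ B1 bB; rewrite scaleNr addrC.
have b0 : counit X (b - e *: 1) = 0.
  by rewrite linearB linearZ /= rmorph1 -/e [_ *: _]mulr1 subrr.
by rewrite tmkDr (linD Fl) (F1 _ _ _ bB' b0) add0r tmkZr (linZ Fl).
Qed.

(** The congruence modulo Omega X ⊗ J, stated through all linear maps that kill it. Quantifying over
    z is what makes it stable under products. *)
Definition base_like (w : OX) := forall (Z : lmodType k) (F : OX ⊗ OX -> Z) z,
  linear F -> kills_base F ->
  F (fcomul OX (w * z)) = F (lmul_left w (fcomul OX z)).

Lemma base_like_lin a u v : base_like u -> base_like v -> base_like (a *: u + v).
Proof.
move=> uB vB Z F z Fl FJ; have lb := lmul_left_bilinear.
rewrite mulrDl -scalerAl linearP Fl uB // vB // -Fl; congr F.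
by rewrite lb.1.
Qed.

Lemma base_like0 : base_like 0.
Proof.
move=> Z F z Fl _; have lb := lmul_left_bilinear.
by rewrite mul0r linear0 (lin_zero (lb.1 _)).
Qed.

Lemma base_likeM u v : base_like u -> base_like v -> base_like (u * v).
Proof.
move=> uB vB Z F z Fl FJ; have lb := lmul_left_bilinear.
rewrite -mulrA uB //.
rewrite (vB _ (fun t => F (lmul_left u t))); [|by linr|exact: kills_base_lmul].
congr F; move: (fcomul OX z); apply: tensor_ext => [||w' z']; [linr|linr|].
by rewrite !lmul_leftE mulrA.
Qed.

Lemma base_like_inc b : b \in B -> base_like (fi b).
Proof.
move=> bB Z F z Fl FJ; have lb := lmul_left_bilinear; have pb := pmul_bilinear OX.
rewrite fcomulM fcomul_inc; move: (fcomul OX z); clear z.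
apply: tensor_ext => [||w z]; [linr|linr|].
rewrite lmul_leftE.
rewrite [LHS](tlift_tmk (f := fun t => F (pm (tmap fi fi t) (w ⊗ z)))); last by linr.
transitivity (tlift (fun a c => F ((fi a * w) ⊗ (fi c * z))) (D b)).
  apply: eq_tlift => a c.
  by rewrite tmapE pmul_tmk (gmul_deg _ _ _ (finc_deg0 _ _)) koszul0.
(* The second leg is averaged into B, there replaced by its counit, and the averaging is then undone
   so that the counit contracts Delta b. *)
rewrite coinv_comul_tlift //; last by linr.
transitivity (tlift (fun a c => counit X (avg c) *: F ((fi a * w) ⊗ z)) (D b)).
  apply: eq_tlift => a c.
  by rewrite (kills_base_counit _ _ Fl FJ (coinv_avgP pi_hopf I_int c)).
rewrite -(coinv_comul_tlift
  (G := fun a c => counit X c *: F ((fi a * w) ⊗ z))) //; last by linr.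
by rewrite (counit_comr (f := fun a => F ((fi a * w) ⊗ z))) //; linr.
Qed.

Lemma fcomul_d_inc x : fcomul OX (fd OX (fi x)) =
  tlift (fun a c => fd OX (fi a) ⊗ fi c + fi a ⊗ fd OX (fi c)) (D x).
Proof.
rewrite fcomul_d fcomul_inc tlift_tmap; last exact: tensor_d_bilinear.
apply: eq_tlift => a c; congr (_ + _ ⊗ _).
by rewrite (koszul_deg _ (finc_deg0 _ _)) muln0 expr0 scale1r.
Qed.

(** Of the terms db_(1) ⊗ b_(2) and b_(1) ⊗ db_(2), the second lies in Omega X ⊗ J and the first
    reduces as for b itself. *)
Lemma base_like_d b : b \in B -> base_like (fd OX (fi b)).
Proof.
move=> bB Z F z Fl FJ; have lb := lmul_left_bilinear; have pb := pmul_bilinear OX.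
rewrite fcomulM fcomul_d_inc; move: (fcomul OX z); clear z.
apply: tensor_ext => [||w z]; [linr|linr|].
rewrite lmul_leftE (tlift_comp (h := fun t => F (pm t (w ⊗ z)))); [|by linr|by linr].
pose G a c := F ((fd OX (fi a) * w) ⊗ (fi c * z)) +
  F ((fi a * koszul (D := dga_of OX) 1 w) ⊗ (fd OX (fi c) * z)).
transitivity (tlift G (D b)).
  apply: eq_tlift => a c; rewrite (linD (pb.1 _)) (linD Fl) !pmul_tmk.
  rewrite (gmul_deg _ _ _ (finc_deg0 _ _)) koszul0.
  by rewrite (gmul_deg _ _ _ (fd_deg (finc_deg0 _ _))).
rewrite coinv_comul_tlift //; last by rewrite /G; linr.
transitivity (tlift (fun a c =>
    counit X (avg c) *: F ((fd OX (fi a) * w) ⊗ z)) (D b)).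
  apply: eq_tlift => a c; have cB := coinv_avgP pi_hopf I_int c.
  by rewrite /G (FJ.2 _ _ _ cB) addr0 (kills_base_counit _ _ Fl FJ cB).
rewrite -(coinv_comul_tlift
  (G := fun a c => counit X c *: F ((fd OX (fi a) * w) ⊗ z))) //; last by linr.
by rewrite (counit_comr (f := fun a => F ((fd OX (fi a) * w) ⊗ z))) //; linr.
Qed.

Lemma sub_formn_base_like n w : sub_formn B n w -> base_like w.
Proof.
elim: n w => [_ [b bB <-]|n IH]; first exact: base_like_inc.
move=> w; apply: sub_formnS.
- move=> u z /IH uB z1; apply: base_likeM => //.
  move: z z1; apply: lin_comb_le.
  + move=> _ [b bB [c cB <-]]; exact: base_likeM (base_like_inc bB) (base_like_d cB).
  + exact: base_like0.
  + exact: base_like_lin.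
- exact: base_like0.
- exact: base_like_lin.
Qed.

End BaseComul.

(** * The fibration property *)

Lemma lspan_val (k : fieldType) (V : lmodType k) (S : set V) z :
  z \in lspan S -> exists u : lsub S, val u = z.
Proof. by move=> zS; exists (LSub zS). Qed.

Section FibrationCriterion.
Variables (k : fieldType) (B X : algType k) (OB : calculus B) (OX : calculus X).
Variable iota : diff_map OB OX.

Local Notation num := (Xi_num iota).
Local Notation cls m n := (@Xi_class k B X OB OX iota m n).

Lemma formn_lspan n (w : lsub (formn OB n)) : formn OB n (val w).
Proof.
have /lspanP := valP w; move: (val w); apply: lin_comb_le => //.
  by rewrite /formn /= linear0.
by move=> a u v uS vS; exact: fcomp_lin_deg.
Qed.

Lemma Xi_class_val m n (u : lsub (num m n)) : cls m n (val u) = lclass _ u.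
Proof. by rewrite /Xi_class valKd. Qed.

Lemma Xi_class_lin m n a z z' : z \in lspan (num m n) -> z' \in lspan (num m n) ->
  cls m n (a *: z + z') = a *: cls m n z + cls m n z'.
Proof.
move=> /lspan_val[u <-] /lspan_val[v <-].
by rewrite -linearP !Xi_class_val linearP.
Qed.

Lemma Xi_class_zero m n : cls m n 0 = 0.
Proof.
have z0 : 0 \in lspan (num m n) by exact: rpred0.
by have := Xi_class_lin (-1) z0 z0; rewrite scaler0 addr0 scaleN1r addNr.
Qed.

Lemma Xi_class0 m n z : z \in lspan (num m n.+1) -> z \in lspan (num m.+1 n) ->
  cls m n.+1 z = 0.
Proof.
move=> /lspan_val[u <-] uS; rewrite Xi_class_val.
apply/eqP; rewrite -(linear0 (lclass _)) lclass_eq subr0.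
exact: sub_lspan.
Qed.

Lemma Xi_num_formn n z : formn OX n z -> z \in lspan (num 0 n).
Proof.
move=> zn; apply: sub_lspan; exists 1.
  by rewrite /formn /= -(rmorph1 (finc OB)) finc_deg0.
by exists z => //; rewrite (dga_map1 (dm_form iota)) mul1r.
Qed.

Lemma formn_Xi_num n z : z \in lspan (num 0 n) -> formn OX n z.
Proof.
move/lspanP; move: z; apply: lin_comb_le => [_ [w w0 [x xn <-]]||a u v uS vS].
- have w0' : formn OX 0 (dm_form iota w).
    by rewrite /formn /= -(dform_comp iota) (w0 : fcomp OB 0 w = w).
  exact: (fmul_deg w0' xn).
- by rewrite /formn /= linear0.
- exact: fcomp_lin_deg.
Qed.

Lemma Xi_num_mull p m n w z : formn OB m w -> z \in lspan (num p n) ->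
  dm_form iota w * z \in lspan (num (m + p) n).
Proof.
move=> wm /lspanP zp; apply/lspanP; move: z zp.
apply: (lin_comb_map (f := fun z => dm_form iota w * z)) => [|_ [u up [x xn <-]]].
  exact: lin_mulr.
rewrite mulrA; apply: lin_comb_gen; exists (w * u); first exact: fmul_deg.
by exists x => //; rewrite (dformM iota).
Qed.

Section Theta.
Variables m n : nat.

Definition theta_pre (w : lsub (formn OB m)) (u : lsub (num 0 n)) : Xi iota m n :=
  cls m n (dm_form iota (val w) * val u).

Lemma theta_num (w : lsub (formn OB m)) (u : lsub (num 0 n)) :
  dm_form iota (val w) * val u \in lspan (num m n).
Proof. by have := Xi_num_mull (formn_lspan w) (valP u); rewrite addn0. Qed.

Lemma theta_pre_bilinear : bilinear_map theta_pre.
Proof.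
split=> [u a v w|w a u v]; rewrite /theta_pre -Xi_class_lin ?theta_num //;
  congr (cls m n _).
  by rewrite !linearP mulrDl scalerAl.
by rewrite linearP mulrDr scalerAr.
Qed.

Lemma theta_pre_den w u : @Xi_den k B X OB OX iota 0 n u -> theta_pre w u = 0.
Proof.
rewrite /theta_pre; have := theta_num w u; move: u.
case: n => [//|n'] u uS /= u1; apply: Xi_class0 => //.
by have := Xi_num_mull (formn_lspan w) u1; rewrite addn1.
Qed.

Lemma theta_bilinear : bilinear_map
  (fun (w : lsub (formn OB m)) (q : Xi iota 0 n) => qlift (theta_pre w) q).
Proof.
split=> [q|w]; last first.
  by apply: qlift_linear; [exact: theta_pre_bilinear.2|exact: theta_pre_den].
by move=> a v w; rewrite /qlift theta_pre_bilinear.1.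
Qed.

Definition theta : lsub (formn OB m) ⊗ Xi iota 0 n -> Xi iota m n :=
  tlift (fun w q => qlift (theta_pre w) q).

Lemma theta_linear : linear theta.
Proof. exact: tlift_linear theta_bilinear. Qed.

Lemma theta_tmk w xi : xi \in lspan (num 0 n) ->
  theta (w ⊗ cls 0 n xi) = cls m n (dm_form iota (val w) * xi).
Proof.
move=> /lspan_val[u <-]; rewrite /theta (tliftE theta_bilinear) Xi_class_val.
by rewrite (qlift_class (theta_pre_bilinear.2 w)) => [//|v]; exact: theta_pre_den.
Qed.

Lemma theta_balance t : @balance_rel k B X OB OX iota m n t -> theta t = 0.
Proof.
case=> w [wb [b [xi [wbE xiS ->]]]].
have bxiS : finc OX (iota b) * xi \in lspan (num 0 n).
  by rewrite -(dm_ext iota); exact: (Xi_num_mull (finc_deg0 OB b) xiS).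
rewrite -scaleN1r addrC theta_linear !theta_tmk // wbE (dformM iota) (dm_ext iota).
by rewrite mulrA scaleN1r addNr.
Qed.

(** It suffices to give the inverse on all of OX. Vanishing on [Xi_den] lets it descend; the formula
    on products makes it a left inverse, and also a right inverse because such products span the
    numerator. *)
Lemma Xi_bijective (Psi : {linear OX -> lquot (@balance_rel k B X OB OX iota m n)}) :
  (forall w xi, formn OX n xi ->
    Psi (dm_form iota (val w) * xi) = lclass _ (w ⊗ cls 0 n xi)) ->
  (forall u, @Xi_den k B X OB OX iota m n u -> Psi (val u) = 0) ->
  exists Theta : {linear lquot (@balance_rel k B X OB OX iota m n) -> Xi iota m n},
    (forall w xi, xi \in lspan (num 0 n) ->
      Theta (lclass _ (w ⊗ cls 0 n xi)) = cls m n (dm_form iota (val w) * xi))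
    /\ bijective Theta.
Proof.
move=> PsiE Psi0.
exists (lmk (qlift_linear theta_linear theta_balance)).
split=> [w xi xiS|].
  by rewrite /= (qlift_class theta_linear theta_balance) theta_tmk.
have pl : linear (fun u : lsub (num m n) => Psi (val u)) by linr.
have tl := qlift_linear theta_linear theta_balance.
have ql := qlift_linear pl Psi0.
have PsiK w xi : formn OX n xi -> qlift (fun u : lsub (num m n) => Psi (val u))
    (cls m n (dm_form iota (val w) * xi)) = lclass _ (w ⊗ cls 0 n xi).
  move=> xin.
  have [u uE] : exists u : lsub (num m n), val u = dm_form iota (val w) * xi.
    apply: lspan_val; apply: sub_lspan; exists (val w) => //.
      exact: formn_lspan.
    by exists xi.
  by rewrite -uE Xi_class_val (qlift_class pl Psi0) uE PsiE.
exists (qlift (fun u : lsub (num m n) => Psi (val u))) => q /=.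
  rewrite -[q]lclass_reprK; move: (repr q).
  apply: tensor_ext => [||w p].
  - exact: (lin_comp ql (lin_comp tl (lin_pack _ (@lin_id _ _)))).
  - exact: (lin_pack _ (@lin_id _ _)).
  rewrite (qlift_class theta_linear theta_balance) -[p]lclass_reprK -Xi_class_val.
  by rewrite theta_tmk ?(valP (repr p)) // PsiK //; exact: formn_Xi_num (valP (repr p)).
have clsK z : lin_comb (num m n) z -> qlift theta (Psi z) = cls m n z.
  elim=> [|a _ v [w wm [x xn <-]] /lspanP vS IH].
    by rewrite Xi_class_zero linear0 (lin_zero tl).
  have [w' wE] : exists w' : lsub (formn OB m), val w' = w by exact/lspan_val/sub_lspan.
  rewrite Xi_class_lin //; last by apply: sub_lspan; exists w => //; exists x.
  rewrite linearP tl IH -wE PsiE // (qlift_class theta_linear theta_balance) theta_tmk //.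
  exact: Xi_num_formn.
rewrite -[q]lclass_reprK (qlift_class pl Psi0) clsK ?Xi_class_val //.
exact/lspanP/(valP (repr q)).
Qed.

End Theta.

End FibrationCriterion.

Section FormDegrees.
Variables (k : fieldType) (A : algType k) (OA : calculus A).

Lemma fcompMl m n w u : fcomp OA m w = w ->
  fcomp OA (m + n) (w * u) = w * fcomp OA n u.
Proof.
move=> wm; move: u; apply: form_ext => [||q u qu]; [linr|linr|].
rewrite (fcompM _ wm qu) eqn_add2l; case: eqP => [->|/eqP nq]; first by rewrite qu.
by rewrite (fcomp_neq qu nq) mulr0.
Qed.

Lemma fcompMl0 m w u : fcomp OA m.+1 w = w -> fcomp OA m (w * u) = 0.
Proof.
move=> wm; move: u; apply: (form_ext (g := fun=> 0)) => [||q u qu]; [linr| |].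
  by move=> a u v; rewrite scaler0 addr0.
by rewrite (fcompM _ wm qu) addSn ltn_eqF // ltnS leq_addr.
Qed.

End FormDegrees.

Lemma lsub_val_linear (k : fieldType) (V : lmodType k) (S : set V) :
  linear (val : lsub S -> V).
Proof. by []. Qed.

(** * The inverse of Theta *)

Section Retractions.
Variables (k : fieldType) (X H : hopfAlg k) (OX : bicovariant X) (OH : bicovariant H).
Variable pi : diff_map OX OH.
Hypothesis pi_hopf : hopf_map pi.
Variables (I : {linear H -> k^o}) (I_int : normalised_left_integral I).

Local Notation fi := (finc OX).
Local Notation B := (coinv pi).
Local Notation OB := (sub_calculus OX B).

Local Notation iota := (sub_inclusion OX B).

Definition lincl m (w : lsub (formn OB m)) : OX := dform iota (val w).

Lemma lincl_linear m : linear (@lincl m).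
Proof. exact: (lin_pack (dform iota) (@lsub_val_linear _ _ _)). Qed.

Lemma linclP m (w : lsub (formn OB m)) : sub_formn B m (lincl w).
Proof. by apply/sub_calculusP; exact: formn_lspan. Qed.

Lemma lincl_inj m : injective (@lincl m).
Proof. by move=> u v uv; apply/val_inj/val_inj. Qed.

Lemma lincl_onto m v : sub_formn B m v -> exists w : lsub (formn OB m), lincl w = v.
Proof.
case/sub_calculus_intro=> w wm <-.
have [w' <-] : exists w' : lsub (formn OB m), val w' = w by exact/lspan_val/sub_lspan.
by exists w'.
Qed.

Lemma base_projection m : exists e : {linear OX -> OX},
  (forall v, baseX pi m (e v)) /\ (forall v, baseX pi m v -> e v = v).
Proof.
have [e [eM eid]] := subspace_projection (lspan_submod_closed
  [set w * fi x | w in sub_formn B m & x in [set: X]]).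
by exists e; split=> [v|v vM]; [apply/lspanP|apply: eid; apply/lspanP].
Qed.

(** Average, then apply a linear left inverse [g] of the inclusion. On Omega^mB.X the average is
    already a form on B, so there r is the average itself, which is right B-linear. *)
Lemma base_retraction m : exists r : {linear OX -> lsub (formn OB m)},
  (forall w, r (lincl w) = w) /\
  (forall z b, baseX pi m z -> b \in B -> lincl (r (z * fi b)) = lincl (r z) * fi b).
Proof.
have [g gP] := generalised_inverse (lmk (@lincl_linear m)).
have al := form_avg_linear pi I.
have rl : linear (fun z : OX => g (form_avg pi I z)) by exact: lin_pack.
have gK w : g (lincl w) = w by apply: lincl_inj; exact: (gP w).
have rv z : baseX pi m z -> lincl (g (form_avg pi I z)) = form_avg pi I z.
  by move=> /(form_avg_baseX pi_hopf I_int)/lincl_onto[w <-]; rewrite gK.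
exists (lmk rl); split=> [w|z b zM bB].
  by rewrite lmkE (form_avg_id I_int (rho_sub_formn (linclP w))) gK.
by rewrite !lmkE (rv _ zM) (rv _ (baseX_mulr b zM)) form_avg_baseM.
Qed.

End Retractions.

Section Inverse.
Variables (k : fieldType) (X H : hopfAlg k) (OX : bicovariant X) (OH : bicovariant H).
Variable pi : diff_map OX OH.
Hypothesis pi_hopf : hopf_map pi.
Variables (I : {linear H -> k^o}) (I_int : normalised_left_integral I).

Local Notation fi := (finc OX).
Local Notation B := (coinv pi).
Local Notation OB := (sub_calculus OX B).
Local Notation iota := (sub_inclusion OX B).
Local Notation D := (comul X).
Local Notation S := (antipode X).
Local Notation avg := (coinv_avg pi I).
Local Notation lc := (@lcoact k X OX).

Variables m n : nat.
Variables (e : {linear OX -> OX}) (r : {linear OX -> lsub (formn OB m)}).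
Hypotheses (eM : forall v, baseX pi m (e v)) (eid : forall v, baseX pi m v -> e v = v).
Hypotheses (rK : forall w, r (lincl w) = w)
  (rM : forall z b, baseX pi m z -> b \in B -> lincl (r (z * fi b)) = lincl (r z) * fi b).

Local Notation Q := (lquot (@balance_rel k (subalg B) X OB OX iota m n)).

(** Legs of a coproduct have components of all degrees, while [Xi_class] is meaningful on n-forms
    only; hence the projection. *)
Definition fib_class (v : OX) : Xi iota 0 n := Xi_class iota 0 n (fcomp OX n v).

Lemma fib_class_linear : linear fib_class.
Proof.
move=> a u v; rewrite /fib_class linearP /= Xi_class_lin //;
  by apply: Xi_num_formn; rewrite /formn /= fcompK eqxx.
Qed.

Lemma fib_class_d b v : b \in B -> fib_class (fd OX (fi b) * v) = 0.
Proof.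
move=> bB; have dbB := sub_form1_d OX bB.
have db1 := sub_form1_deg dbB.
rewrite /fib_class.
have [w w1 wE] := sub_calculus_intro (sub_form1_formn dbB).
(* For n = 0 nothing is divided out, but db v has no component of degree 0. *)
case: n => [|n'].
  by rewrite (fcompMl0 _ db1) Xi_class_zero.
rewrite -add1n (fcompMl _ _ db1) add1n; apply: Xi_class0.
  apply: Xi_num_formn; rewrite /formn /=.
  by rewrite -add1n (fcompMl _ _ db1) fcompK eqxx.
apply: sub_lspan; exists w => //; exists (fcomp OX n' v).
  by rewrite /formn /= fcompK eqxx.
by rewrite -wE.
Qed.

Definition pair_class (z v : OX) : Q := lclass _ (r z ⊗ fib_class v).

Lemma pair_class_bilinear : bilinear_map pair_class.
Proof.
have fl := fib_class_linear.
split=> c; rewrite /pair_class; apply: lin_pack; last exact: lin_tmkr.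
by apply: lin_tmkl; exact: lin_pack.
Qed.

(** The relation of the tensor product over B involves r(z) b; it equals r(z b) by right B-linearity
    of r on Omega^mB.X. *)
Lemma pair_class_balance z b v : baseX pi m z -> b \in B ->
  pair_class z (fi b * v) = pair_class (z * fi b) v.
Proof.
move=> zM bB; apply/eqP; rewrite eq_sym /pair_class lclass_eq; apply: sub_lspan.
have fE : fib_class (fi b * v) = Xi_class iota 0 n (fi b * fcomp OX n v).
  by rewrite /fib_class -[n in fcomp OX n (_ * _)]add0n (fcompMl _ _ (finc_deg0 OX b)).
exists (r z), (r (z * fi b)), (SubAlg bB), (fcomp OX n v); split.
- by apply: val_inj; exact: rM.
- by apply: Xi_num_formn; rewrite /formn /= fcompK eqxx.
- by rewrite fE.
Qed.

(* Inverts w ⊗ v |-> w v_[-1] ⊗ v_[0] by v_[-2] S(v_[-1]) = 1; the averaging   *)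
(* built into r brings the first leg back into the forms on B.                *)
Definition twist (z v : OX) : Q := tlift (fun y g => pair_class (z * fi (S y)) g) (lc v).

Lemma twist_bilinear : bilinear_map twist.
Proof. by have pb := pair_class_bilinear; rewrite /twist; linr. Qed.

Definition inv_pre (t : OX ⊗ OX) : Q :=
  tlift (fun u v => twist (e (fcomp OX m u)) v) t.

Lemma inv_pre_bilinear : bilinear_map (fun u v => twist (e (fcomp OX m u)) v).
Proof. by have tb := twist_bilinear; linr. Qed.

Lemma inv_pre_linear : linear inv_pre.
Proof. exact: tlift_linear inv_pre_bilinear. Qed.

(** S reverses products, so balancing gives z S(b_(1) y) ⊗ b_(2) g = z S(y) S(b_(1)) b_(2) ⊗ g =
    eps(b) z S(y) ⊗ g. Averaging b_(2) makes the balancing legitimate. *)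
Lemma twist_inc z b v : baseX pi m z -> b \in B -> counit X b = 0 ->
  twist z (fi b * v) = 0.
Proof.
move=> zM bB b0; have pb := pair_class_bilinear.
rewrite /twist lcoactM lcoact_inc.
move: (lc v); apply: (tensor_ext (g := fun=> 0)) => [||y g]; [linr| |].
  by move=> a s t; rewrite scaler0 addr0.
rewrite tlift_tmul; last by linr.
rewrite tlift_tmap; last by linr.
transitivity (tlift (fun a c => pair_class (z * fi (S y * S a)) (fi c * g)) (D b)).
  apply: eq_tlift => a c; rewrite tliftE; last by linr.
  by rewrite antipodeM.
rewrite (coinv_comul_tlift I_int _ bB); last by linr.
transitivity (tlift (fun a c => pair_class (z * fi (S y * (S a * avg c))) g) (D b)).
  apply: eq_tlift => a c; rewrite pair_class_balance.
  - by rewrite -mulrA -rmorphM mulrA.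
  - exact: baseX_mulr.
  - exact: coinv_avgP.
rewrite -(coinv_comul_tlift
  (G := fun a c => pair_class (z * fi (S y * (S a * c))) g) I_int _ bB);
  last by linr.
rewrite -(tlift_comp (h := fun x => pair_class (z * fi (S y * x)) g)
  (f := fun a c => S a * c)); [|by linr|by linr].
by rewrite antipodel b0 scale0r mulr0 linear0 mulr0 (lin_zero (pb.1 _)).
Qed.

(** The left coaction of db v is b_(1) v_[-1] ⊗ db_(2) v_[0]; with b_(2) averaged into B, the second
    leg has class 0 in Xi_0^n. *)
Lemma twist_d z b v : b \in B -> twist z (fd OX (fi b) * v) = 0.
Proof.
move=> bB; have pb := pair_class_bilinear.
rewrite /twist lcoactM lcoact_d lcoact_inc.
move: (lc v); apply: (tensor_ext (g := fun=> 0)) => [||y g]; [linr| |].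
  by move=> a s t; rewrite scaler0 addr0.
rewrite tlift_tmul; last by linr.
rewrite tlift_tmap; last by linr.
rewrite tlift_tmap; last by linr.
transitivity (tlift (fun a c =>
    pair_class (z * fi (S (a * y))) (fd OX (fi c) * g)) (D b)).
  by apply: eq_tlift => a c; rewrite tliftE; last by linr.
rewrite (coinv_comul_tlift I_int _ bB); last by linr.
transitivity (tlift (fun a c => 0 : Q) (D b)).
  apply: eq_tlift => a c; have cB := coinv_avgP pi_hopf I_int c.
  by rewrite /pair_class (fib_class_d _ cB) tmk0r linear0.
have zb : bilinear_map (fun (a c : X) => 0 : Q).
  by split=> ? a u v'; rewrite scaler0 addr0.
move: (D b); apply: (tensor_ext (g := fun=> 0)) => [||u w]; [linr| |by rewrite tliftE].
by move=> a s t; rewrite scaler0 addr0.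
Qed.

Lemma inv_pre_kills : kills_base pi inv_pre.
Proof.
by split=> *; rewrite /inv_pre (tliftE inv_pre_bilinear) ?twist_inc ?twist_d.
Qed.

Lemma inv_pre_den w v : sub_formn B m.+1 w -> inv_pre (fcomul OX (w * v)) = 0.
Proof.
move=> wB; have il := inv_pre_linear; have ib := inv_pre_bilinear.
have lb := lmul_left_bilinear OX.
rewrite (sub_formn_base_like pi_hopf I_int wB _ il inv_pre_kills).
move: (fcomul OX v); apply: (tensor_ext (g := fun=> 0)) => [||u z]; [linr| |].
  by move=> a s t; rewrite scaler0 addr0.
rewrite lmul_leftE /inv_pre (tliftE ib) (fcompMl0 _ (sub_formn_deg wB)).
by rewrite linear0 (lin_zero (twist_bilinear.1 _)).
Qed.

(** As eta is left-invariant, the sum is z x_(1) S(x_(2)) ⊗ eta x_(3), which the antipode axiom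
    contracts. *)
Lemma twist_linv z eta x : baseX pi m z -> linv (OX := OX) n eta ->
  tlift (fun a c => twist (z * fi a) (eta * fi c)) (D x) = pair_class z (eta * fi x).
Proof.
move=> zM [_ etal]; have pb := pair_class_bilinear.
pose f a c d := pair_class (z * fi (a * S c)) (eta * fi d).
have ft : trilinear_map f by split=> ? ?; rewrite /f; linr.
transitivity (tlift (fun a b => tlift (f a) (D b)) (D x)).
  apply: eq_tlift => a b; rewrite /twist lcoactM etal lcoact_inc.
  rewrite tlift_tmul; last by linr.
  rewrite tliftE; last by linr.
  rewrite tlift_tmap; last by linr.
  by apply: eq_tlift => c d; rewrite mul1r -mulrA -rmorphM.
rewrite -comul_coassoc //.
rewrite -[RHS](counit_coml (f := fun x => pair_class z (eta * fi x))); last by linr.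
apply: eq_tlift => a d; rewrite /f.
rewrite -(tlift_comp (h := fun y => pair_class (z * fi y) (eta * fi d))
  (f := fun a c => a * S c)); [|by linr|by linr].
rewrite antipoder linearZ /= rmorph1 -scalerAr mulr1.
by rewrite (linZ (pb.1 _)).
Qed.

Lemma inv_pre_base w v : formn OX n v ->
  inv_pre (fcomul OX (lincl w * v)) = lclass _ (w ⊗ Xi_class iota 0 n v).
Proof.
move=> vn; have il := inv_pre_linear; have ib := inv_pre_bilinear.
have lb := lmul_left_bilinear OX; have wB := linclP w.
have tb := twist_bilinear; have pb := pair_class_bilinear.
rewrite (sub_formn_base_like pi_hopf I_int wB _ il inv_pre_kills).
transitivity (tlift (fun y g => twist (lincl w * fi y) g) (lc v)).
  rewrite lcoactE tlift_tmap; last by linr.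
  move: (fcomul OX v); apply: tensor_ext => [||u z]; [linr|linr|].
  rewrite lmul_leftE /inv_pre (tliftE ib) tliftE; last by linr.
  (* The component of degree m of w u is w times the degree 0 part of u, and [e] fixes it. *)
  rewrite -[m in fcomp OX m]addn0 (fcompMl _ _ (sub_formn_deg wB)) fcomp0E eid //.
  by apply: baseX_mulr; exact: sub_formn_baseX.
transitivity (pair_class (lincl w) v); last by rewrite /pair_class rK /fib_class vn.
(* By linearity v may be taken of the form eta x with eta left-invariant, the case of
   [twist_linv]. *)
have vS := form_span vn; move: v vS {vn}.
apply: lin_comb_eq => [||_ [eta eta1 [x _ <-]]]; [linr|linr|].
rewrite -(twist_linv _ _ eta1); last exact: sub_formn_baseX.
rewrite lcoactM eta1.2 lcoact_inc tlift_tmul; last by linr.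
rewrite tliftE; last by linr.
rewrite tlift_tmap; last by linr.
by apply: eq_tlift => a c; rewrite mul1r.
Qed.

End Inverse.

Theorem theorem10p5 (k : fieldType) (X H : hopfAlg k)
    (OX : bicovariant X) (OH : bicovariant H) (pi : diff_map OX OH) :
  hopf_map pi ->
  (forall h : H, exists x : X, pi x = h) ->
  conditionK pi ->
  (exists I : {linear H -> k^o}, normalised_left_integral I) ->
  (forall n,
     [set dm_form (sub_inclusion OX (coinv pi)) w |
       w in formn (sub_calculus OX (coinv pi)) n] =
     [set wedge_form u | u in kerX_coinv pi n]) /\
  diff_fibration (sub_inclusion OX (coinv pi)).
Proof.
move=> pi_hopf _ condK [I I_int]; split=> [n|m n].
  exact: (coinvariant_forms pi_hopf condK I_int).
have [e [eM eid]] := base_projection pi m.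
have [r [rK rM]] := base_retraction pi_hopf I_int m.
have il := @inv_pre_linear _ _ _ _ _ pi m n e r.
have Pl : linear (fun z => @inv_pre _ _ _ _ _ pi m n e r (fcomul OX z)).
  exact: (lin_comp il (lin_pack _ (@lin_id _ _))).
apply: (@Xi_bijective _ _ _ _ _ _ m n (lmk Pl)) => [w v vn|u].
  exact: (inv_pre_base pi_hopf I_int eM eid rK rM w vn).
case: n il Pl u => [//|n] il Pl u /lspanP.
apply: (lin_comb_lin0 (f := lmk Pl)) => [|_ [w wm [v vn <-]]]; first exact: linearP.
exact: (inv_pre_den pi_hopf I_int n.+1 eM rM v ((sub_calculusP _ w).1 wm)).
Qed.
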